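(* Let $k, m, n \ge 1$ be integers. Then $V_k \pi_m(S^n)$ is a subgroup of $\pi_m(S^n)$, and $V_k \pi_m(S^n) \subset V_{k+1} \pi_m(S^n)$.
   Context: Spheres carry the standard round (unit sphere) Riemannian metrics. For a $C^1$ map $f : M \to N$ between Riemannian manifolds and an integer $k\ge 1$, the $k$-dilation of $f$ is the supremum over $x \in M$ of the operator norm $|\Lambda^k df_x|$ of the $k$-fold exterior power $\Lambda^k df_x : \Lambda^k T_xM \to \Lambda^k T_{f(x)}N$; at each point this norm is the product of the $k$ largest singular values of $df_x$ (and is $0$ if $k > \dim M$ or $k > \dim N$). For integers $k,m,n \ge 1$, $V_k \pi_m(S^n) \subset \pi_m(S^n)$ denotes the set of homotopy classes $a \in \pi_m(S^n)$ such that for every $\delta > 0$ there is a $C^1$ map $S^m \to S^n$ in the class $a$ with $k$-dilation less than $\delta$. *)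

(* Defs.v *)
From HB Require Import structures.
From mathcomp Require Import all_boot all_order all_algebra generic_quotient.
From mathcomp Require Import ring lra.
From mathcomp Require Import all_classical all_reals all_analysis.

Set Implicit Arguments.
Unset Strict Implicit.
Unset Printing Implicit Defensive.

Import Order.TTheory GRing.Theory Num.Theory.
Import numFieldNormedType.Exports.

Local Open Scope classical_set_scope.
Local Open Scope ring_scope.
Local Open Scope quotient_scope.

(** * Homotopy groups

   [homotopy_group m A x0] is pi_m(A, x0) for a subset A of a topological space,
   as the set of classes of maps (I^m, bd I^m) -> (A, x0), I = [0, 1], modulo
   homotopy relative to bd I^m. The maps are total functions on R^m of which
   only the restriction to I^m matters. *)

Definition unit_itv (R : realType) : set R := [set s | 0 <= s <= 1].

Definition cube (R : realType) (m : nat) : set 'rV[R]_m :=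
  [set t | forall i, 0 <= t ord0 i <= 1].

Definition cube_boundary (R : realType) (m : nat) : set 'rV[R]_m :=
  [set t | cube t /\ exists i, t ord0 i = 0 \/ t ord0 i = 1].

Record cube_map (R : realType) (T : topologicalType) (m : nat) (A : set T)
    (x0 : A) := CubeMap {
  cube_fun :> 'rV[R]_m -> T;
  cube_map_continuous : {within @cube R m, continuous cube_fun};
  cube_map_sub : forall t, cube t -> A (cube_fun t);
  cube_map_boundary : forall t, cube_boundary t -> cube_fun t = val x0 }.
Arguments cube_map R {T} m {A} x0.
Arguments cube_map_continuous {R T m A x0} c.

HB.instance Definition _ (R : realType) (T : topologicalType) m (A : set T)
  (x0 : A) := gen_eqMixin (cube_map R m x0).
HB.instance Definition _ (R : realType) (T : topologicalType) m (A : set T)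
  (x0 : A) := gen_choiceMixin (cube_map R m x0).

Definition homotopic (R : realType) (T : topologicalType) (m : nat) (A : set T)
    (x0 : A) (f g : cube_map R m x0) : Prop :=
  exists H : R * 'rV[R]_m -> T,
    [/\ {within @unit_itv R `*` @cube R m, continuous H},
        forall s t, unit_itv s -> cube t -> A (H (s, t)),
        forall s t, unit_itv s -> cube_boundary t -> H (s, t) = val x0,
        forall t, cube t -> H (0, t) = f t
      & forall t, cube t -> H (1, t) = g t].

Section within_continuity.

Lemma within_comp (X Y Z : topologicalType) (P : set X) (Q : set Y)
    (phi : X -> Y) (f : Y -> Z) :
  {within Q, continuous f} -> continuous phi -> (forall x, P x -> Q (phi x)) ->
  {within P, continuous (f \o phi)}.
Proof.
move=> /subspace_continuousP fc pc PQ; apply/subspace_continuousP => x Px.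
move=> U Uf; have h1 : within Q (nbhs (phi x)) (f @^-1` U).
  exact: (fc _ (PQ _ Px) U Uf).
have h2 : nbhs x (fun z => Q (phi z) -> U (f (phi z))) := pc x _ h1.
by apply: filterS h2 => y /= h Py; apply: h; exact: PQ.
Qed.

Lemma within_glue (R : realType) (X Z : topologicalType) (P : set X)
    (c : X -> R) (a : R) (u v : X -> Z) :
  closed P -> continuous c ->
  {within P `&` [set x | c x <= a], continuous u} ->
  {within P `&` [set x | a <= c x], continuous v} ->
  (forall x, P x -> c x = a -> u x = v x) ->
  {within P, continuous (fun x => if c x <= a then u x else v x)}.
Proof.
move=> cP cc uc vc uv.
have -> : P = (P `&` [set x | c x <= a]) `|` (P `&` [set x | a <= c x]).
  apply/seteqP; split=> [x Px|x [[]|[]]//].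
  by case: (leP (c x) a) => h; [left|right; split=> //=; exact: ltW].
have h1 : closed (P `&` [set x | c x <= a]).
  by apply: closedI => //; apply: preimage_closed (@closed_le _ a) => ? _; exact: cc.
have h2 : closed (P `&` [set x | a <= c x]).
  by apply: closedI => //; apply: preimage_closed (@closed_ge _ a) => ? _; exact: cc.
apply: withinU_continuous => //.
- by apply: subspace_eq_continuous uc => x /[!inE] -[_ /= h]; rewrite /from_subspace /= h.
- apply: subspace_eq_continuous vc => x /[!inE] -[Px /= h].
  rewrite /from_subspace /=; case: ifP => // h'; apply/esym/uv => //.
  by apply/le_anti; rewrite h h'.
Qed.

Lemma mx_continuous (R : realType) (X : topologicalType) m n
    (F : X -> 'M[R]_(m, n)) :
  (forall i j, continuous (fun x => F x i j)) -> continuous F.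
Proof.
move=> Fc x U [P PF PU].
have : \forall y \near x, forall i j, P i j (F y i j).
  apply: (@filter_forall _ _ (fun i y => forall j, P i j (F y i j))) => i.
  by apply: (@filter_forall _ _ (fun j y => P i j (F y i j))) => j; exact: Fc.
by apply: filterS => y h; exact: PU.
Qed.


Lemma pair_continuous (X Y Z : topologicalType) (f : X -> Y) (g : X -> Z) :
  continuous f -> continuous g -> continuous (fun x => (f x, g x)).
Proof. by move=> cf cg x; apply: cvg_pair; [exact: cf|exact: cg]. Qed.

Lemma affine_continuous (R : realType) (X : topologicalType) (a b : R)
    (c : X -> R) : continuous c -> continuous (fun x => a * c x + b).
Proof.
move=> cc x; apply: (@cvgD _ R^o); last exact: cvg_cst.
by apply: cvgM; [exact: cvg_cst | exact: cc].
Qed.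

Lemma scale_continuous (R : realType) (X : topologicalType) (a : R)
    (c : X -> R) : continuous c -> continuous (fun x => a * c x).
Proof. by move=> cc x; apply: cvgM; [exact: cvg_cst | exact: cc]. Qed.

Lemma rsub_continuous (R : realType) (X : topologicalType) (a : R)
    (c : X -> R) : continuous c -> continuous (fun x => a - c x).
Proof. by move=> cc x; apply: (@cvgB _ R^o); [exact: cvg_cst | exact: cc]. Qed.

Lemma cube_closed (R : realType) m : closed (@cube R m).
Proof.
have -> : @cube R m = \bigcap_(i in [set: 'I_m])
    ((fun t : 'rV[R]_m => t ord0 i) @^-1` [set c | 0 <= c] `&`
     (fun t : 'rV[R]_m => t ord0 i) @^-1` [set c | c <= 1]).
  apply/seteqP; split=> t /= h i; first by move=> _; exact/andP/h.
  by have /andP := h i I.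
apply: closed_bigI => i _; apply: closedI.
  by apply: preimage_closed (@closed_ge _ 0) => ? _; exact: coord_continuous.
by apply: preimage_closed (@closed_le _ 1) => ? _; exact: coord_continuous.
Qed.

Lemma unit_cube_closed (R : realType) m :
  closed (@unit_itv R `*` @cube R m).
Proof.
have -> : @unit_itv R `*` @cube R m =
    (fst @^-1` [set c | 0 <= c] `&` fst @^-1` [set c | c <= 1]) `&`
    snd @^-1` @cube R m.
  apply/seteqP; split=> -[s t] /=; first by move=> [/andP[]].
  by move=> [[s0 s1] ct]; split=> //; exact/andP.
apply: closedI; first apply: closedI.
- by apply: preimage_closed (@closed_ge _ 0) => ? _; exact: cvg_fst.
- by apply: preimage_closed (@closed_le _ 1) => ? _; exact: cvg_fst.
- by apply: preimage_closed (@cube_closed _ _) => ? _; exact: cvg_snd.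
Qed.

End within_continuity.

Section homotopic_equiv.
Context {R : realType} {T : topologicalType} {m : nat} {A : set T} {x0 : A}.
Implicit Types f g h : cube_map R m x0.

Lemma eq_homotopic f g : (forall t, cube t -> f t = g t) -> homotopic f g.
Proof.
move=> fg; exists (f \o snd); split=> //=.
- apply: (within_comp (phi := @snd R _) (cube_map_continuous f)).
    by move=> ?; exact: cvg_snd.
  by move=> ? [].
- by move=> s t _ ct; exact: cube_map_sub.
- by move=> s t _ ct; exact: cube_map_boundary.
Qed.

Lemma homotopic_refl f : homotopic f f.
Proof. exact: eq_homotopic. Qed.

Lemma homotopic_sym f g : homotopic f g -> homotopic g f.
Proof.
move=> [H [Hc HA Hb H0 H1]].
exists (fun p => H (-1 * p.1 + 1, p.2)).
have rI s : @unit_itv R s -> @unit_itv R (-1 * s + 1).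
  by rewrite /unit_itv /= => h; lra.
split=> /=.
- apply: (within_comp (phi := fun p : R * 'rV[R]_m => (-1 * p.1 + 1, p.2)) Hc).
    apply: pair_continuous; last by move=> ?; exact: cvg_snd.
    by apply: affine_continuous => ?; exact: cvg_fst.
  by move=> [s t] [/= /rI].
- by move=> s t /rI; exact: HA.
- by move=> s t /rI; exact: Hb.
- by move=> t ct; rewrite mulr0 add0r H1.
- by move=> t ct; rewrite mulr1 addNr H0.
Qed.

Lemma homotopic_trans f g h : homotopic f g -> homotopic g h -> homotopic f h.
Proof.
move=> [H [Hc HA Hb H0 H1]] [K [Kc KA Kb K0 K1]].
exists (fun p => if p.1 <= 2^-1 then H (2 * p.1 + 0, p.2)
                 else K (2 * p.1 + - 1, p.2)).
have lI s : @unit_itv R s -> s <= 2^-1 -> @unit_itv R (2 * s + 0).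
  by rewrite /unit_itv /= => ??; lra.
have rI s : @unit_itv R s -> 2^-1 <= s -> @unit_itv R (2 * s + - 1).
  by rewrite /unit_itv /= => ??; lra.
have c2 a : continuous (fun p : R * 'rV[R]_m => (2 * p.1 + a, p.2)).
  apply: pair_continuous; last by move=> ?; exact: cvg_snd.
  by apply: affine_continuous => ?; exact: cvg_fst.
split=> /=.
- apply: (within_glue (c := @fst R 'rV[R]_m)).
  + exact: unit_cube_closed.
  + by move=> ?; exact: cvg_fst.
  + apply: (within_comp Hc (c2 0)).
    by move=> [s t] [[/= sI ct] hs]; split=> //; exact: lI.
  + apply: (within_comp Kc (c2 (- 1))).
    by move=> [s t] [[/= sI ct] hs]; split=> //; exact: rI.
  + move=> [s t] [/= _ ct] ->; rewrite divff ?pnatr_eq0// subrr addr0.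
    by rewrite H1 ?K0.
- move=> s t sI ct; case: (leP s 2^-1) => hs.
    by apply: HA => //; exact: lI.
  by apply: KA => //; apply: rI => //; exact: ltW.
- move=> s t sI ct; case: (leP s 2^-1) => hs.
    by apply: Hb => //; exact: lI.
  by apply: Kb => //; apply: rI => //; exact: ltW.
- by move=> t ct; rewrite mulr0 addr0 invr_ge0 ler0n H0.
- move=> t ct; rewrite ifF; last by apply/negbTE; lra.
  by rewrite mulr1 (_ : 2 + - 1 = 1) ?K1 //; lra.
Qed.

Definition homotopic_rel f g : bool := `[< homotopic f g >].

Lemma homotopic_rel_refl : reflexive homotopic_rel.
Proof. by move=> f; exact/asboolP/homotopic_refl. Qed.

Lemma homotopic_rel_sym : symmetric homotopic_rel.
Proof. by move=> f g; apply/asboolP/asboolP; exact: homotopic_sym. Qed.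

Lemma homotopic_rel_trans : transitive homotopic_rel.
Proof.
by move=> g f h /asboolP fg /asboolP gh; exact/asboolP/(homotopic_trans fg gh).
Qed.

Canonical homotopic_equiv :=
  EquivRel homotopic_rel homotopic_rel_refl homotopic_rel_sym
    homotopic_rel_trans.

End homotopic_equiv.

Definition homotopy_group (R : realType) (T : topologicalType) (m : nat)
    (A : set T) (x0 : A) : Type :=
  {eq_quot @homotopic_rel R T m A x0}.
Arguments homotopy_group R {T} m {A} x0.

HB.instance Definition _ (R : realType) (T : topologicalType) m (A : set T)
  (x0 : A) := EqQuotient.on (homotopy_group R m x0).
HB.instance Definition _ (R : realType) (T : topologicalType) m (A : set T)
  (x0 : A) := Choice.on (homotopy_group R m x0).

Definition homotopy_class (R : realType) (T : topologicalType) (m : nat)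
    (A : set T) (x0 : A) (f : cube_map R m x0) : homotopy_group R m x0 :=
  \pi_(homotopy_group R m x0) f.

Lemma homotopy_classP (R : realType) (T : topologicalType) (m : nat)
    (A : set T) (x0 : A) (f g : cube_map R m x0) :
  homotopy_class f = homotopy_class g <-> homotopic f g.
Proof.
split=> [/eqmodP/asboolP//|fg]; exact/eqmodP/asboolP.
Qed.

(** ** Group structure, by concatenation in the first coordinate *)

Section homotopy_group_law.
Context {R : realType} {T : topologicalType} {m : nat} {A : set T} {x0 : A}.
Implicit Types (f g h : cube_map R m.+1 x0) (t : 'rV[R]_m.+1).

Definition set_first t (c : R) : 'rV[R]_m.+1 :=
  \row_i (if i == ord0 then c else t ord0 i).

Lemma set_firstE t c : set_first t c ord0 ord0 = c.
Proof. by rewrite mxE eqxx. Qed.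

Lemma set_first_set t c d : set_first (set_first t c) d = set_first t d.
Proof. by apply/rowP => i; rewrite !mxE; case: eqP. Qed.

Lemma set_first_id t : set_first t (t ord0 ord0) = t.
Proof. by apply/rowP => i; rewrite !mxE; case: eqP => // ->. Qed.

Lemma set_first_cube t c : cube t -> unit_itv c -> cube (set_first t c).
Proof. by move=> ct cI i; rewrite mxE; case: eqP. Qed.

Lemma set_first_boundary t c : cube_boundary t -> unit_itv c ->
  (t ord0 ord0 = 0 \/ t ord0 ord0 = 1 -> c = 0 \/ c = 1) ->
  cube_boundary (set_first t c).
Proof.
move=> [ct [i hi]] cI h; split; first exact: set_first_cube.
have [i0|i0] := eqVneq i ord0.
  by exists ord0; rewrite set_firstE; apply: h; rewrite -i0.
by exists i; rewrite mxE (negbTE i0).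
Qed.

Lemma first_itv t : cube t -> 0 <= t ord0 ord0 <= 1.
Proof. exact. Qed.

Lemma set_first_continuous (X : topologicalType) (F : X -> 'rV[R]_m.+1)
    (c : X -> R) :
  continuous F -> continuous c -> continuous (fun x => set_first (F x) (c x)).
Proof.
move=> cF cc; apply: mx_continuous => i j.
have [->|j0] := eqVneq j ord0.
  rewrite (_ : (fun x => _) = c) //.
  by apply/funext => x; rewrite mxE eqxx.
rewrite (_ : (fun x => _) = (fun M : 'rV[R]_m.+1 => M ord0 j) \o F).
  by move=> x; apply: continuous_comp; [exact: cF|exact: coord_continuous].
by apply/funext => x; rewrite mxE (negbTE j0).
Qed.

Definition cube_cst_fun (t : 'rV[R]_m.+1) : T := val x0.

Definition cube_inv_fun f t : T := f (set_first t (1 - t ord0 ord0)).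

Definition cube_mul_fun f g t : T :=
  if t ord0 ord0 <= 2^-1 then f (set_first t (2 * t ord0 ord0))
  else g (set_first t (2 * t ord0 ord0 - 1)).

Definition reparam f (phi : R -> R) t : T := f (set_first t (phi (t ord0 ord0))).

Lemma reparam_homotopy f (phi psi : R -> R) :
  continuous phi -> continuous psi ->
  (forall c, unit_itv c -> unit_itv (phi c)) ->
  (forall c, unit_itv c -> unit_itv (psi c)) ->
  phi 0 = psi 0 -> phi 1 = psi 1 ->
  (phi 0 = 0 \/ phi 0 = 1) -> (phi 1 = 0 \/ phi 1 = 1) ->
  exists H : R * 'rV[R]_m.+1 -> T,
    [/\ {within @unit_itv R `*` @cube R m.+1, continuous H},
        forall s t, unit_itv s -> cube t -> A (H (s, t)),
        forall s t, unit_itv s -> cube_boundary t -> H (s, t) = val x0,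
        forall t, cube t -> H (0, t) = reparam f phi t
      & forall t, cube t -> H (1, t) = reparam f psi t].
Proof.
move=> cphi cpsi Iphi Ipsi e0 e1 b0 b1.
pose chi (p : R * 'rV[R]_m.+1) : R :=
  (- 1 * p.1 + 1) * phi (p.2 ord0 ord0) + p.1 * psi (p.2 ord0 ord0).
have cf : continuous (fun p : R * 'rV[R]_m.+1 => p.2 ord0 ord0).
  move=> p; apply: (@continuous_comp _ _ _ snd
    (fun M : 'rV[R]_m.+1 => M ord0 ord0)); first exact: cvg_snd.
  exact: coord_continuous.
have cchi : continuous chi.
  have c1 (q : R -> R) : continuous q ->
      continuous (fun p : R * 'rV[R]_m.+1 => q (p.2 ord0 ord0)).
    move=> cq p; apply: (@continuous_comp _ _ _
      (fun p : R * 'rV[R]_m.+1 => p.2 ord0 ord0) q); [exact: cf|exact: cq].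
  move=> p; apply: (@cvgD _ R^o); apply: cvgM; try exact: c1.
    by apply: affine_continuous => ?; exact: cvg_fst.
  exact: cvg_fst.
have Ichi s t : unit_itv s -> cube t -> unit_itv (chi (s, t)).
  move=> sI ct; have := Iphi _ (ct ord0); have := Ipsi _ (ct ord0).
  move: sI; rewrite /unit_itv /chi /=.
  move: (phi _) (psi _) => a b /andP[? ?] /andP[? ?] /andP[? ?].
  by apply/andP; split; nra.
exists (fun p => f (set_first p.2 (chi p))); split => /=.
- apply: (within_comp (phi := fun p : R * 'rV[R]_m.+1 => set_first p.2 (chi p))
    (cube_map_continuous f)).
    by apply: set_first_continuous => // ?; exact: cvg_snd.
  move=> [s t] [/= sI ct]; apply: set_first_cube => //; exact: Ichi.
- move=> s t sI ct; apply: cube_map_sub; apply: set_first_cube => //; exact: Ichi.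
- move=> s t sI bt; apply: cube_map_boundary; apply: set_first_boundary => //.
    by apply: Ichi => //; case: bt.
  have eA a : (- 1 * s + 1) * a + s * a = a by ring.
  by rewrite /chi /= => -[] ->; rewrite -?e0 -?e1 eA.
- by move=> t ct; rewrite /chi /= /reparam mulr0 add0r mul1r mul0r addr0.
- by move=> t ct; rewrite /chi /= /reparam mulr1 addNr mul0r mul1r add0r.
Qed.

Lemma reparam_homotopic f (phi psi : R -> R) g h :
  continuous phi -> continuous psi ->
  (forall c, unit_itv c -> unit_itv (phi c)) ->
  (forall c, unit_itv c -> unit_itv (psi c)) ->
  phi 0 = psi 0 -> phi 1 = psi 1 ->
  (phi 0 = 0 \/ phi 0 = 1) -> (phi 1 = 0 \/ phi 1 = 1) ->
  (forall t, cube t -> g t = reparam f phi t) ->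
  (forall t, cube t -> h t = reparam f psi t) ->
  homotopic g h.
Proof.
move=> cphi cpsi Iphi Ipsi e0 e1 b0 b1 Eg Eh.
have [H [Hc HA Hb H0 H1]] := reparam_homotopy f cphi cpsi Iphi Ipsi e0 e1 b0 b1.
by exists H; split=> // t ct; [rewrite H0 ?Eg|rewrite H1 ?Eh].
Qed.

Fact cube_cst_subproof :
  [/\ {within @cube R m.+1, continuous cube_cst_fun},
      forall t, cube t -> A (cube_cst_fun t)
    & forall t, cube_boundary t -> cube_cst_fun t = val x0].
Proof.
split=> // [|t _]; last exact: set_mem (valP x0).
by apply: continuous_subspaceT => ?; exact: cst_continuous.
Qed.

Definition cube_cst : cube_map R m.+1 x0 :=
  let: And3 c s b := cube_cst_subproof in CubeMap c s b.

Fact cube_inv_subproof f :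
  [/\ {within @cube R m.+1, continuous (cube_inv_fun f)},
      forall t, cube t -> A (cube_inv_fun f t)
    & forall t, cube_boundary t -> cube_inv_fun f t = val x0].
Proof.
have I1 t : cube t -> unit_itv (1 - t ord0 ord0).
  by move=> /first_itv; rewrite /unit_itv /= => ?; lra.
split=> [|t ct|t bt].
- apply: (within_comp (phi := fun t => set_first t (1 - t ord0 ord0))
    (cube_map_continuous f)).
    apply: set_first_continuous; first by move=> ?; exact: cvg_id.
    by apply: rsub_continuous; exact: coord_continuous.
  by move=> t ct; apply: set_first_cube => //; exact: I1.
- by apply: cube_map_sub; apply: set_first_cube => //; exact: I1.
- apply: cube_map_boundary; apply: set_first_boundary => //.
    by apply: I1; case: bt.
  by case=> ->; [right; rewrite subr0|left; rewrite subrr].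
Qed.

Definition cube_inv f : cube_map R m.+1 x0 :=
  let: And3 c s b := cube_inv_subproof f in CubeMap c s b.

Let lI (c : R) : unit_itv c -> c <= 2^-1 -> unit_itv (2 * c).
Proof. by rewrite /unit_itv /= => ??; lra. Qed.

Let rI (c : R) : unit_itv c -> 2^-1 <= c -> unit_itv (2 * c - 1).
Proof. by rewrite /unit_itv /= => ??; lra. Qed.

Let set_first01 t c : cube t -> c = 0 \/ c = 1 ->
  cube_boundary (set_first t c).
Proof.
move=> ct c01; split; last by exists ord0; rewrite set_firstE.
by apply: set_first_cube => //; rewrite /unit_itv /=; case: c01 => ->; lra.
Qed.

Fact cube_mul_subproof f g :
  [/\ {within @cube R m.+1, continuous (cube_mul_fun f g)},
      forall t, cube t -> A (cube_mul_fun f g t)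
    & forall t, cube_boundary t -> cube_mul_fun f g t = val x0].
Proof.
split=> [|t ct|t bt].
- apply: (within_glue (c := fun t : 'rV[R]_m.+1 => t ord0 ord0)).
  + exact: cube_closed.
  + exact: coord_continuous.
  + apply: (within_comp (phi := fun t => set_first t (2 * t ord0 ord0))
      (cube_map_continuous f)).
      apply: set_first_continuous; first by move=> ?; exact: cvg_id.
      apply: scale_continuous.
      exact: coord_continuous.
    by move=> t [ct tl]; apply: set_first_cube => //; exact: (lI (first_itv ct) tl).
  + apply: (within_comp (phi := fun t => set_first t (2 * t ord0 ord0 - 1))
      (cube_map_continuous g)).
      apply: set_first_continuous; first by move=> ?; exact: cvg_id.
      apply: affine_continuous.
      exact: coord_continuous.
    by move=> t [ct tl]; apply: set_first_cube => //; exact: (rI (first_itv ct) tl).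
  + move=> t ct ->; rewrite divff ?pnatr_eq0// subrr.
    by rewrite !cube_map_boundary //; apply: set_first01 => //; [left|right].
- rewrite /cube_mul_fun; case: leP => h; apply: cube_map_sub;
    apply: set_first_cube => //; [exact: (lI (first_itv ct) h)|exact: (rI (first_itv ct) (ltW h))].
- rewrite /cube_mul_fun; case: leP => h; apply: cube_map_boundary;
    apply: set_first_boundary => //.
  + exact: (lI (first_itv (proj1 bt)) h).
  + by case=> e; move: h; rewrite e => h; [left; lra|exfalso; lra].
  + exact: (rI (first_itv (proj1 bt)) (ltW h)).
  + by case=> e; move: h; rewrite e => h; [exfalso; lra|right; lra].
Qed.

Definition cube_mul f g : cube_map R m.+1 x0 :=
  let: And3 c s b := cube_mul_subproof f g in CubeMap c s b.

Lemma cube_cstE t : cube_cst t = val x0.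
Proof. by rewrite /cube_cst; case: cube_cst_subproof. Qed.

Lemma cube_invE f t : cube_inv f t = f (set_first t (1 - t ord0 ord0)).
Proof. by rewrite /cube_inv; case: cube_inv_subproof. Qed.

Lemma cube_mulE f g t : cube_mul f g t =
  if t ord0 ord0 <= 2^-1 then f (set_first t (2 * t ord0 ord0))
  else g (set_first t (2 * t ord0 ord0 - 1)).
Proof. by rewrite /cube_mul; case: cube_mul_subproof. Qed.

Lemma homotopic_inv f g : homotopic f g -> homotopic (cube_inv f) (cube_inv g).
Proof.
move=> [H [Hc HA Hb H0 H1]].
have I1 t : cube t -> unit_itv (- 1 * t ord0 ord0 + 1).
  by move=> /first_itv; rewrite /unit_itv /= => ?; lra.
pose phi (p : R * 'rV[R]_m.+1) :=
  (p.1, set_first p.2 (- 1 * p.2 ord0 ord0 + 1)).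
exists (fun p => H (phi p)); split=> /=.
- apply: (within_comp (phi := phi) Hc).
    apply: pair_continuous; first by move=> ?; exact: cvg_fst.
    apply: set_first_continuous; first by move=> ?; exact: cvg_snd.
    apply: affine_continuous => p; apply: (@continuous_comp _ _ _ snd
      (fun M : 'rV[R]_m.+1 => M ord0 ord0)); first exact: cvg_snd.
    exact: coord_continuous.
  by move=> [s t] [/= sI ct]; split=> //; apply: set_first_cube => //; exact: I1.
- by move=> s t sI ct; apply: HA => //; apply: set_first_cube => //; exact: I1.
- move=> s t sI bt; apply: Hb => //; apply: set_first_boundary => //.
    by apply: I1; case: bt.
  by case=> ->; [right|left]; lra.
- move=> t ct; rewrite H0; last by apply: set_first_cube => //; exact: I1.
  by rewrite cube_invE mulN1r addrC.
- move=> t ct; rewrite H1; last by apply: set_first_cube => //; exact: I1.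
  by rewrite cube_invE mulN1r addrC.
Qed.

Lemma homotopic_mul f f' g g' : homotopic f f' -> homotopic g g' ->
  homotopic (cube_mul f g) (cube_mul f' g').
Proof.
move=> [H [Hc HA Hb H0 H1]] [K [Kc KA Kb K0 K1]].
exists (fun p : R * 'rV[R]_m.+1 => if p.2 ord0 ord0 <= 2^-1
  then H (p.1, set_first p.2 (2 * p.2 ord0 ord0))
  else K (p.1, set_first p.2 (2 * p.2 ord0 ord0 - 1))).
have cf : continuous (fun p : R * 'rV[R]_m.+1 => p.2 ord0 ord0).
  move=> p; apply: (@continuous_comp _ _ _ snd
    (fun M : 'rV[R]_m.+1 => M ord0 ord0)); first exact: cvg_snd.
  exact: coord_continuous.
have cl t : cube t -> t ord0 ord0 <= 2^-1 ->
    cube (set_first t (2 * t ord0 ord0)).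
  by move=> ct h; apply: set_first_cube => //; exact: (lI (first_itv ct) h).
have cr t : cube t -> 2^-1 < t ord0 ord0 ->
    cube (set_first t (2 * t ord0 ord0 - 1)).
  by move=> ct h; apply: set_first_cube => //; exact: (rI (first_itv ct) (ltW h)).
split=> /=.
- apply: (within_glue (c := fun p : R * 'rV[R]_m.+1 => p.2 ord0 ord0)) => //.
  + exact: unit_cube_closed.
  + apply: (within_comp (phi := fun p : R * 'rV[R]_m.+1 =>
        (p.1, set_first p.2 (2 * p.2 ord0 ord0))) Hc).
      apply: pair_continuous; first by move=> ?; exact: cvg_fst.
      apply: set_first_continuous; first by move=> ?; exact: cvg_snd.
      exact: scale_continuous.
    by move=> [s t] [/= [sI ct] h]; split=> //; exact: cl.
  + apply: (within_comp (phi := fun p : R * 'rV[R]_m.+1 =>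
        (p.1, set_first p.2 (2 * p.2 ord0 ord0 - 1))) Kc).
      apply: pair_continuous; first by move=> ?; exact: cvg_fst.
      apply: set_first_continuous; first by move=> ?; exact: cvg_snd.
      exact: affine_continuous.
    by move=> [s t] [/= [sI ct] h]; split=> //; apply: set_first_cube => //; exact: (rI (first_itv ct) h).
  + move=> [s t] [/= sI ct] ->; rewrite divff ?pnatr_eq0// subrr.
    by rewrite Hb ?Kb //; apply: set_first01 => //; [left|right].
- by move=> s t sI ct; case: leP => h; [apply: HA|apply: KA] => //; [exact: cl|exact: cr].
- move=> s t sI bt; have ct := proj1 bt.
  case: leP => h; [apply: Hb|apply: Kb] => //; apply: set_first_boundary => //.
  + exact: (lI (first_itv ct) h).
  + by case=> e; move: h; rewrite e => h; [left; lra|exfalso; lra].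
  + exact: (rI (first_itv ct) (ltW h)).
  + by case=> e; move: h; rewrite e => h; [exfalso; lra|right; lra].
- move=> t ct; rewrite cube_mulE.
  by case: leP => h; [rewrite H0//; exact: cl|rewrite K0//; exact: cr].
- move=> t ct; rewrite cube_mulE.
  by case: leP => h; [rewrite H1//; exact: cl|rewrite K1//; exact: cr].
Qed.

Let id_continuous : continuous (fun c : R => c).
Proof. by move=> ?; exact: cvg_id. Qed.

Let minc (a b : R -> R) : continuous a -> continuous b ->
  continuous (fun c => Num.min (a c) (b c)).
Proof. by move=> ca cb c; apply: continuous_min; [exact: ca|exact: cb]. Qed.

Let maxc (a b : R -> R) : continuous a -> continuous b ->
  continuous (fun c => Num.max (a c) (b c)).
Proof. by move=> ca cb c; apply: continuous_max; [exact: ca|exact: cb]. Qed.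

Lemma cube_mulA f g h :
  homotopic (cube_mul f (cube_mul g h)) (cube_mul (cube_mul f g) h).
Proof.
apply/homotopic_sym.
apply: (@reparam_homotopic (cube_mul f (cube_mul g h))
  (fun c => Num.min (2 * c) (Num.min (1 * c + 4^-1) (2^-1 * c + 2^-1))) id) => //.
- apply: minc; first exact: scale_continuous.
  by apply: minc; exact: affine_continuous.
- move=> c; rewrite /unit_itv /= => /andP[c0 c1].
  by rewrite !le_min !ge_min; lra.
- by rewrite minElt; case: ifP; rewrite minElt; case: ifP => /=; lra.
- by rewrite minElt; case: ifP; rewrite minElt; case: ifP => /=; lra.
- by left; rewrite minElt; case: ifP; rewrite minElt; case: ifP => /=; lra.
- by right; rewrite minElt; case: ifP; rewrite minElt; case: ifP => /=; lra.
- move=> t ct; rewrite /reparam.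
  have := first_itv ct; move E : (t ord0 ord0) => c /andP[c0 c1].
  rewrite cube_mulE E; case: (leP c 2^-1) => h1.
    rewrite cube_mulE set_firstE; case: (leP (2 * c) 2^-1) => h2.
      rewrite min_l; last by rewrite le_min; apply/andP; split; lra.
      by rewrite cube_mulE set_firstE h2 !set_first_set.
    rewrite min_r; last by rewrite ge_min; apply/orP; left; lra.
    rewrite min_l; last lra.
    rewrite cube_mulE set_firstE ifF; last by apply/negbTE; lra.
    rewrite cube_mulE set_firstE ifT; last lra.
    by rewrite !set_first_set; congr (g (set_first _ _)); field.
  rewrite min_r; last by rewrite ge_min; apply/orP; right; lra.
  rewrite min_r; last lra.
  rewrite cube_mulE set_firstE ifF; last by apply/negbTE; lra.
  rewrite cube_mulE set_firstE ifF; last by apply/negbTE; lra.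
  by rewrite !set_first_set; congr (h (set_first _ _)); field.
- by move=> t ct; rewrite /reparam set_first_id.
Qed.

Lemma cube_mul1 f : homotopic (cube_mul f cube_cst) f.
Proof.
apply: (@reparam_homotopic f (fun c => Num.min (2 * c) 1) id) => //.
- apply: minc; first exact: scale_continuous.
  by move=> ?; exact: cst_continuous.
- move=> c; rewrite /unit_itv /= => /andP[c0 c1].
  by rewrite le_min ge_min; lra.
- by rewrite minElt; case: ifP => /=; lra.
- by rewrite minElt; case: ifP => /=; lra.
- by left; rewrite minElt; case: ifP; lra.
- by right; rewrite minElt; case: ifP; lra.
- move=> t ct; rewrite /reparam cube_mulE; case: leP => h.
    by rewrite min_l //; lra.
  rewrite min_r; last lra.
  by rewrite cube_cstE cube_map_boundary //; apply: set_first01 => //; right.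
- by move=> t ct; rewrite /reparam set_first_id.
Qed.

Lemma cube_1mul f : homotopic (cube_mul cube_cst f) f.
Proof.
apply: (@reparam_homotopic f (fun c => Num.max 0 (2 * c - 1)) id) => //.
- apply: maxc; first by move=> ?; exact: cst_continuous.
  exact: affine_continuous.
- move=> c; rewrite /unit_itv /= => /andP[c0 c1].
  by rewrite le_max ge_max; lra.
- by rewrite maxElt; case: ifP => /=; lra.
- by rewrite maxElt; case: ifP => /=; lra.
- by left; rewrite maxElt; case: ifP; lra.
- by right; rewrite maxElt; case: ifP; lra.
- move=> t ct; rewrite /reparam cube_mulE; case: leP => h.
    rewrite max_l; last lra.
    by rewrite cube_cstE cube_map_boundary //; apply: set_first01 => //; left.
  by rewrite max_r //; lra.
- by move=> t ct; rewrite /reparam set_first_id.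
Qed.

Lemma cube_mulV f : homotopic (cube_mul f (cube_inv f)) cube_cst.
Proof.
apply: (@reparam_homotopic f (fun c => Num.min (2 * c) (- 2 * c + 2))
  (fun=> 0)) => //.
- by apply: minc; [exact: scale_continuous|exact: affine_continuous].
- by move=> ?; exact: cst_continuous.
- move=> c; rewrite /unit_itv /= => /andP[c0 c1].
  by rewrite le_min ge_min; lra.
- by move=> c _; rewrite /unit_itv /=; lra.
- by rewrite minElt; case: ifP => /=; lra.
- by rewrite minElt; case: ifP => /=; lra.
- by left; rewrite minElt; case: ifP; lra.
- by left; rewrite minElt; case: ifP; lra.
- move=> t ct; rewrite /reparam cube_mulE; case: leP => h.
    by rewrite min_l //; lra.
  rewrite min_r; last lra.
  rewrite cube_invE set_first_set set_firstE; congr (f (set_first _ _)); ring.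
- move=> t ct; rewrite /reparam cube_cstE cube_map_boundary //.
  by apply: set_first01 => //; left.
Qed.

Lemma cube_Vmul f : homotopic (cube_mul (cube_inv f) f) cube_cst.
Proof.
apply: (@reparam_homotopic f (fun c => Num.max (- 2 * c + 1) (2 * c - 1))
  (fun=> 1)) => //.
- by apply: maxc; exact: affine_continuous.
- by move=> ?; exact: cst_continuous.
- move=> c; rewrite /unit_itv /= => /andP[c0 c1].
  by rewrite le_max ge_max; lra.
- by move=> c _; rewrite /unit_itv /=; lra.
- by rewrite maxElt; case: ifP => /=; lra.
- by rewrite maxElt; case: ifP => /=; lra.
- by right; rewrite maxElt; case: ifP; lra.
- by right; rewrite maxElt; case: ifP; lra.
- move=> t ct; rewrite /reparam cube_mulE; case: leP => h.
    rewrite max_l; last lra.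
    rewrite cube_invE set_first_set set_firstE; congr (f (set_first _ _)); ring.
  by rewrite max_r //; lra.
- move=> t ct; rewrite /reparam cube_cstE cube_map_boundary //.
  by apply: set_first01 => //; right.
Qed.

End homotopy_group_law.

Section homotopy_group_instance.
Context (R : realType) (T : topologicalType) (m : nat) (A : set T) (x0 : A).
Local Notation G := (homotopy_group R m.+1 x0).
Implicit Types a b c : G.

Definition homotopy_one : G := homotopy_class cube_cst.
Definition homotopy_inv a : G := homotopy_class (cube_inv (repr a)).
Definition homotopy_mul a b : G := homotopy_class (cube_mul (repr a) (repr b)).

Lemma homotopic_repr (f : cube_map R m.+1 x0) :
  homotopic (repr (homotopy_class f)) f.
Proof. by apply/homotopy_classP; rewrite /homotopy_class reprK. Qed.

Lemma homotopy_class_repr a : homotopy_class (repr a) = a.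
Proof. exact: reprK. Qed.

Lemma homotopy_class_mul (f g : cube_map R m.+1 x0) :
  homotopy_mul (homotopy_class f) (homotopy_class g) =
  homotopy_class (cube_mul f g).
Proof. by apply/homotopy_classP; apply: homotopic_mul; exact: homotopic_repr. Qed.

Lemma homotopy_class_inv (f : cube_map R m.+1 x0) :
  homotopy_inv (homotopy_class f) = homotopy_class (cube_inv f).
Proof. by apply/homotopy_classP; apply: homotopic_inv; exact: homotopic_repr. Qed.

Lemma homotopy_mulA : associative homotopy_mul.
Proof.
move=> a b c; rewrite -(homotopy_class_repr a) -(homotopy_class_repr b).
rewrite -(homotopy_class_repr c) !homotopy_class_mul; apply/homotopy_classP.
exact: cube_mulA.
Qed.

Lemma homotopy_mul1g : left_id homotopy_one homotopy_mul.
Proof.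
move=> a; rewrite -(homotopy_class_repr a) homotopy_class_mul.
by apply/homotopy_classP; exact: cube_1mul.
Qed.

Lemma homotopy_mulg1 : right_id homotopy_one homotopy_mul.
Proof.
move=> a; rewrite -(homotopy_class_repr a) homotopy_class_mul.
by apply/homotopy_classP; exact: cube_mul1.
Qed.

Lemma homotopy_mulVg : left_inverse homotopy_one homotopy_inv homotopy_mul.
Proof.
move=> a; rewrite -(homotopy_class_repr a) homotopy_class_inv homotopy_class_mul.
by apply/homotopy_classP; exact: cube_Vmul.
Qed.

Lemma homotopy_mulgV : right_inverse homotopy_one homotopy_inv homotopy_mul.
Proof.
move=> a; rewrite -(homotopy_class_repr a) homotopy_class_inv homotopy_class_mul.
by apply/homotopy_classP; exact: cube_mulV.
Qed.

HB.instance Definition _ := isGroup.Build G homotopy_mulA homotopy_mul1g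
  homotopy_mulg1 homotopy_mulVg homotopy_mulgV.

End homotopy_group_instance.

(** * Round spheres *)

Definition l2norm (R : realType) (I : finType) (w : I -> R) : R :=
  Num.sqrt (\sum_i w i ^+ 2).

Definition sphere (R : realType) (n : nat) : set 'rV[R]_n.+1 :=
  [set x | l2norm (x ord0) = 1].
Arguments sphere R n : clear implicits.

Lemma sphere_base_subproof (R : realType) n :
  (delta_mx ord0 ord0 : 'rV[R]_n.+1) \in sphere R n.
Proof.
apply/mem_set; rewrite /sphere /l2norm /= (bigD1 ord0) //= big1 => [|i i0].
  by rewrite mxE !eqxx addr0 expr1n sqrtr1.
by rewrite mxE (negbTE i0) andbF expr0n.
Qed.

Definition sphere_base (R : realType) (n : nat) : sphere R n :=
  SigSub (sphere_base_subproof R n).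

(* The quotient map I^m -> I^m / bd I^m = S^m. With u = 2 t - 1 in [-1, 1]^m
   and |u| its max norm (the norm of 'rV_m), t is sent to the point at angular
   distance pi |u| from - sphere_base in the direction of u. It is a
   homeomorphism from the open cube onto S^m minus sphere_base and sends the
   boundary of the cube to sphere_base. *)
Definition cube_to_sphere (R : realType) (m : nat) (t : 'rV[R]_m) :
    'rV[R]_m.+1 :=
  let u : 'rV[R]_m := 2 *: t - const_mx 1 in
  row_mx (const_mx (- cos (pi * `|u|)) : 'rV[R]_1)
         ((sin (pi * `|u|) / l2norm (u ord0)) *: u).

(* A map S^m -> S^n is a total function on R^(m+1) of which only the restriction
   to S^m matters. Its calculus is that of its extension to R^(m+1) \ {0}, by
   precomposition with the smooth retraction x |-> x / |x| onto S^m. *)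
Definition radial_ext (R : realType) (m n : nat)
    (f : 'rV[R]_m.+1 -> 'rV[R]_n.+1) (x : 'rV[R]_m.+1) : 'rV[R]_n.+1 :=
  f ((l2norm (x ord0))^-1 *: x).

Definition C1_sphere_map (R : realType) (m n : nat)
    (f : 'rV[R]_m.+1 -> 'rV[R]_n.+1) : Prop :=
  [/\ forall x, sphere R m x -> sphere R n (f x),
      forall x, x != 0 -> differentiable (radial_ext f) x
    & forall x v, x != 0 ->
        {for x, continuous (fun y => 'd (radial_ext f) y v)}].

Definition tangent_vector (R : realType) (m : nat) (x v : 'rV[R]_m.+1) : Prop :=
  v *m x^T = 0.

(* At x in S^m the differential T_x S^m -> T_(f x) S^n of f is the restriction
   to T_x S^m = x^perp of this map: the retraction has identity differential on
   T_x S^m. *)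
Definition sphere_diff (R : realType) (m n : nat)
    (f : 'rV[R]_m.+1 -> 'rV[R]_n.+1) (x : 'rV[R]_m.+1) :
    'rV[R]_m.+1 -> 'rV[R]_n.+1 :=
  'd (radial_ext f) x.

(** * Exterior powers

   An element of Lambda^k R^N is given by its coordinates in the basis
   e_I = e_(I 0) /\ ... /\ e_(I (k - 1)), I increasing. This basis is orthonormal
   for the inner product
   < v_1 /\ ... /\ v_k, w_1 /\ ... /\ w_k > = det (< v_i, w_j >),
   so that the norm on Lambda^k R^N is [l2norm]. *)

Definition multi_index (k N : nat) : finType :=
  {I : {ffun 'I_k -> 'I_N} | [forall i : 'I_k, forall j : 'I_k, (i < j)%N ==> (I i < I j)%N]}.

Definition ext_power (R : realType) (k N : nat) : Type :=
  {ffun multi_index k N -> R}.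

(* v_1 /\ ... /\ v_k, where v_1, ..., v_k are the rows of V *)
Definition wedge_rows (R : realType) (k N : nat) (V : 'M[R]_(k, N)) :
    ext_power R k N :=
  [ffun I : multi_index _ _ => \det (\matrix_(i < k, j < k) V i (val I j))].

(* Lambda^k L : e_I |-> L e_(I 0) /\ ... /\ L e_(I (k - 1)) *)
Definition ext_power_map (R : realType) (k M N : nat)
    (L : 'rV[R]_M -> 'rV[R]_N) (w : ext_power R k M) : ext_power R k N :=
  [ffun J : multi_index _ _ => \sum_I
    w I * wedge_rows (\matrix_(i < k) L (delta_mx ord0 (val I i))) J].

(* Lambda^k T_x S^m, as a subspace of Lambda^k R^(m+1) *)
Definition tangent_ext_power (R : realType) (k m : nat) (x : 'rV[R]_m.+1) :
    set (ext_power R k m.+1) :=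
  [set w | exists r (V : 'I_r -> 'M[R]_(k, m.+1)),
    (forall j i, tangent_vector x (row i (V j))) /\
    w = [ffun I : multi_index _ _ => \sum_(j < r) wedge_rows (V j) I]].

(* The operator norm of Lambda^k df_x : Lambda^k T_x S^m -> Lambda^k T_(f x) S^n *)
Definition ext_power_diff_norm (R : realType) (k m n : nat)
    (f : 'rV[R]_m.+1 -> 'rV[R]_n.+1) (x : 'rV[R]_m.+1) : \bar R :=
  ereal_sup [set (l2norm (ext_power_map (sphere_diff f x) w))%:E | w in
    [set w : ext_power R k m.+1 | tangent_ext_power x w /\ l2norm w <= 1]].

Definition dilation (R : realType) (k m n : nat)
    (f : 'rV[R]_m.+1 -> 'rV[R]_n.+1) : \bar R :=
  ereal_sup [set ext_power_diff_norm k f x | x in sphere R m].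

(* f : S^m -> S^n represents the class a in pi_m(S^n); in particular f maps
   [sphere_base] to [sphere_base]. *)
Definition in_homotopy_class (R : realType) (m n : nat)
    (f : 'rV[R]_m.+1 -> 'rV[R]_n.+1)
    (a : homotopy_group R m (sphere_base R n)) : Prop :=
  exists2 g : cube_map R m (sphere_base R n),
    a = homotopy_class g & forall t, cube t -> g t = f (cube_to_sphere t).

Definition small_dilation_classes (R : realType) (k m n : nat) :
    set (homotopy_group R m (sphere_base R n)) :=
  [set a | forall delta : R, 0 < delta ->
    exists f : 'rV[R]_m.+1 -> 'rV[R]_n.+1,
      [/\ C1_sphere_map f, in_homotopy_class f a
        & (dilation k f < delta%:E)%E]].
Arguments small_dilation_classes R k m n : clear implicits.

(* Main.v *)
Require Import Defs.
From HB Require Import structures.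
From mathcomp Require Import all_boot all_order all_fingroup all_algebra.
From mathcomp Require Import ring lra.
From mathcomp Require Import all_classical all_reals all_analysis.

(** The k-dilation of a map is bounded above and below, up to constants that
    depend only on k and on the dimensions, by the largest k x k minor of its
    Jacobian. Since det (adj M) = (det M)^k for a minor M of order k + 1, small
    minors of order k force small minors of order k + 1, whence the inclusion.

    For the subgroup property, let f and g represent a and b. The map
    [doubling] : S^(m+1) -> S^(m+1) (up to normalization) stretches the half
    sphere [x axis1 <= 0] over the whole sphere and collapses the other half to
    the base point. It is C^1, so that f o doubling still has small k-dilation,
    and its differential is radial on the collapsed half. Gluing f o doubling on
    one half sphere with the mirror image of g o doubling on the other half
    gives a C^1 map with small k-dilation. Seen from the cube, [doubling] is never
    antipodal to the reparametrization [pinch] that enters the concatenation of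
    cubes; hence the straight segment between them, to which f and g are applied
    through their radial extension, is a homotopy to a representative of a / b. *)

Set Implicit Arguments.
Unset Strict Implicit.
Unset Printing Implicit Defensive.

Import Order.TTheory GRing.Theory Num.Theory.
Import numFieldNormedType.Exports.

Local Open Scope classical_set_scope.
Local Open Scope ring_scope.

(** * Cauchy-Binet formula *)

Section Cauchy_Binet.
Context {R : comRingType}.

(** Multilinearity in the rows: every row of [V *m B] is a combination of rows of [B], and [f]
    records which row of [B] is picked in each of them. *)
Lemma det_mulmx_ffun k M (V : 'M[R]_(k, M)) (B : 'M[R]_(M, k)) :
  \det (V *m B) =
  \sum_(f : {ffun 'I_k -> 'I_M}) (\prod_i V i (f i)) * \det (rowsub f B).
Proof.
rewrite /determinant.
under eq_bigr => s _ do under eq_bigr => i _ do rewrite mxE.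
under eq_bigr => s _ do rewrite bigA_distr_bigA mulr_sumr /=.
rewrite exchange_big /=; apply: eq_bigr => f _; rewrite mulr_sumr.
apply: eq_bigr => s _; rewrite big_split mulrCA; congr (_ * (_ * _)).
by apply: eq_bigr => i _; rewrite mxE.
Qed.

Lemma multi_index_lt k M (I : multi_index k M) (i j : 'I_k) :
  (i < j)%N -> (val I i < val I j)%N.
Proof. by have /forallP/(_ i)/forallP/(_ j)/implyP := valP I. Qed.

Lemma multi_index_le k M (I : multi_index k M) (i j : 'I_k) :
  (val I i <= val I j)%N = (i <= j)%N.
Proof.
apply/idP/idP; last first.
  rewrite leq_eqVlt => /predU1P[/val_inj ->//|/(multi_index_lt I)/ltnW//].
by apply: contraTT; rewrite -!ltnNge; exact: multi_index_lt.
Qed.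

Lemma multi_index_inj k M (I : multi_index k M) : injective (val I).
Proof.
move=> i j e; apply/val_inj/eqP.
by rewrite eqn_leq -!(multi_index_le I) e leqnn.
Qed.

Lemma sorted_enum_ord_in M (A : {set 'I_M}) : sorted ltn (map val (enum A)).
Proof.
have -> : enum A = [seq i <- enum 'I_M | i \in A] by rewrite [in RHS]enumT.
rewrite sorted_map; apply: sorted_filter; first by move=> j i l; exact: ltn_trans.
by rewrite -sorted_map val_enum_ord iota_ltn_sorted.
Qed.

(** The index [I] lists the image of [f] in increasing order, and [s i] is the rank of [f i] in that
    list. *)
Lemma injective_multi_index_perm k M (f : {ffun 'I_k -> 'I_M}) : injective f ->
  exists (I : multi_index k M) (s : 'S_k), f = [ffun i => val I (s i)].
Proof.
move=> finj; pose A := f @: 'I_k.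
have cA : size (enum A) = k by rewrite -cardE card_imset ?card_ord.
(* The empty index is treated apart: [nth] below takes [f ord0] as its default value. *)
case: k f finj @A cA => [|k] f finj A cA.
  have I0 : [forall i : 'I_0, forall j : 'I_0, (i < j)%N ==> (f i < f j)%N].
    by apply/forallP => -[].
  by exists (exist _ f I0), 1%g; apply/ffunP => -[].
pose g := [ffun i : 'I_k.+1 => nth (f ord0) (enum A) i].
have gI : [forall i : 'I_k.+1, forall j : 'I_k.+1, (i < j)%N ==> (g i < g j)%N].
  apply/forallP => i; apply/forallP => j; apply/implyP => ij; rewrite !ffunE.
  have := sorted_enum_ord_in A.
  move/(sorted_ltn_nth ltn_trans 0%N)/(_ i j).
  rewrite !inE !size_map !cA !(nth_map (f ord0)) ?cA //; exact.
have sI i : (index (f i) (enum A) < k.+1)%N.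
  by rewrite -[X in (_ < X)%N]cA index_mem mem_enum imset_f.
pose s i : 'I_k.+1 := Ordinal (sI i).
have fs i : f i = g (s i).
  by rewrite ffunE nth_index // mem_enum imset_f.
have sinj : injective s by move=> i j e; apply: finj; rewrite !fs e.
exists (exist _ g gI), (perm sinj); apply/ffunP => i.
by rewrite ffunE permE -fs.
Qed.

(** As both indices are strictly increasing, [s^-1 * t] preserves the order, and the identity is the
    only permutation that does. *)
Lemma multi_index_perm_inj k M (I J : multi_index k M) (s t : 'S_k) :
  [ffun i => val I (s i)] = [ffun i => val J (t i)] -> I = J /\ s = t.
Proof.
move=> /ffunP e.
have e' i : val I i = val J (t ((s^-1)%g i)).
  by have := e ((s^-1)%g i); rewrite !ffunE permKV.
pose u := (s^-1 * t)%g.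
have e'' i : val I i = val J (u i) by rewrite permM.
have um i j : (u i <= u j)%N = (i <= j)%N.
  by rewrite -(multi_index_le J) -!e'' multi_index_le.
have u1 : u = 1%g.
  suff ui n : forall i : 'I_k, val i = n -> u i = i.
    by apply/permP => i; rewrite perm1 (ui i).
  (* All smaller points are fixed by induction. So the preimage of [i] is at least [i], which gives
     [u i <= i] by monotonicity, and [u i < i] would make [u i] a fixed point, against
     injectivity. *)
  elim/ltn_ind: n => n IH i ein; apply/val_inj/eqP; rewrite eqn_leq.
  apply/andP; split.
  - pose j := (u^-1)%g i; have uj : u j = i by rewrite permKV.
    have [ji|ij] := ltnP j i.
      have := IH j; rewrite -ein => /(_ ji _ erefl) h.
      by rewrite uj in h; move: ji; rewrite -h ltnn.
    by have := um i j; rewrite uj ij => ->.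
  - rewrite leqNgt; apply/negP => h.
    have := IH (u i); rewrite -ein => /(_ h _ erefl)/perm_inj e0.
    by move: h; rewrite e0 ltnn.
have st : s = t by apply/(mulgI (s^-1)%g); rewrite mulVg -/u u1.
split=> //; apply/val_inj/ffunP => i.
by rewrite e'' u1 perm1.
Qed.

(** In the expansion over all [f], a non-injective [f] repeats a row of [B] and contributes 0. An
    injective one is uniquely a multi-index composed with a permutation [s]; the sign of [s], which
    comes out of [\det (rowsub f B)], turns the sum over [s] into a minor of [V]. *)
Lemma det_mulmx_rect k M (V : 'M[R]_(k, M)) (B : 'M[R]_(M, k)) :
  \det (V *m B) =
  \sum_(I : multi_index k M) \det (colsub (val I) V) * \det (rowsub (val I) B).
Proof.
rewrite det_mulmx_ffun (bigID (fun f : {ffun _ -> _} => injectiveb f)) /=.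
rewrite [X in _ + X]big1 ?addr0; last first.
  move=> f /injectivePn[i [j ij fij]].
  rewrite (@determinant_alternate _ _ _ i j) ?mulr0 // => l.
  by rewrite !mxE fij.
pose h (p : multi_index k M * 'S_k) := [ffun i => val p.1 (p.2 i)].
have hinj : {in predT &, injective h}.
  by move=> [I s] [J t] _ _ /multi_index_perm_inj[/= -> ->].
rewrite (eq_bigl [in h @: predT]); last first.
  move=> f; apply/injectiveP/imsetP => [/injective_multi_index_perm[I [s ->]]|].
    by exists (I, s).
  by move=> [[I s] _ ->] i j; rewrite !ffunE => /multi_index_inj/perm_inj.
rewrite big_imset //=.
rewrite (eq_bigr (fun p : multi_index k M * 'S_k => (\prod_i V i (val p.1 (p.2 i))) *
   ((-1) ^+ p.2 * \det (rowsub (val p.1) B)))); last first.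
  move=> [I s] _ /=; congr (_ * _).
    by apply: eq_bigr => i _; rewrite ffunE.
  rewrite (_ : rowsub _ B = row_perm s (rowsub (val I) B)); last first.
    by apply/matrixP => i j; rewrite !mxE ffunE.
  by rewrite row_permE det_mulmx det_perm.
rewrite (eq_bigl xpredT) //.
rewrite -(pair_bigA _ (fun (I : multi_index k M) (s : 'S_k) =>
  (\prod_i V i (val I (s i))) * ((-1) ^+ s * \det (rowsub (val I) B)))) /=.
apply: eq_bigr => I _; rewrite [in RHS]/determinant mulr_suml.
apply: eq_bigr => s _; rewrite mulrCA mulrA; congr (_ * _ * _).
by apply: eq_bigr => i _; rewrite mxE.
Qed.

End Cauchy_Binet.

(** * Minors and dilation *)

Section minors.
Context {R : realFieldType}.

(** These minors are the entries of the matrix of Lambda^k A in the bases e_I: this is an entrywise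
    bound on the exterior power. *)
Definition minors_le k M N (A : 'M[R]_(M, N)) (c : R) : Prop :=
  forall (I : multi_index k M) (J : multi_index k N),
    `|\det (mxsub (val I) (val J) A)| <= c.

Lemma det_le k (A : 'M[R]_k) (e : R) :
  (forall i j, `|A i j| <= e) -> `|\det A| <= k`!%:R * e ^+ k.
Proof.
move=> Ae; rewrite /determinant; apply: le_trans (ler_norm_sum _ _ _) _.
have -> : k`!%:R * e ^+ k = \sum_(s : 'S_k) e ^+ k.
  by rewrite sumr_const mulr_natl -[X in _ = _ *+ X]/(#|'S_k|) card_Sn.
apply: ler_sum => s _; rewrite normrM normrX normrN1 expr1n mul1r normr_prod.
rewrite -[X in _ ^+ X]card_ord -prodr_const; apply: ler_prod => i _.
by rewrite normr_ge0 Ae.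
Qed.

Lemma minors_le_entries k M N (A : 'M[R]_(M, N)) (e : R) :
  (forall i j, `|A i j| <= e) -> minors_le k A (k`!%:R * e ^+ k).
Proof. by move=> Ae I J; apply: det_le => i j; rewrite mxE. Qed.

Lemma minors_le_mulmx k M N P (A : 'M[R]_(M, P)) (B : 'M[R]_(P, N)) (a b : R) :
  minors_le k A a -> minors_le k B b ->
  minors_le k (A *m B) (#|multi_index k P|%:R * (a * b)).
Proof.
move=> Aa Bb I J.
have -> : mxsub (val I) (val J) (A *m B) =
    rowsub (val I) A *m colsub (val J) B.
  by apply/matrixP => i j; rewrite !mxE; apply: eq_bigr => l _; rewrite !mxE.
rewrite det_mulmx_rect; apply: le_trans (ler_norm_sum _ _ _) _.
rewrite mulr_natl -sumr_const; apply: ler_sum => K _; rewrite normrM.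
apply: ler_pM => //.
- have := Aa I K; congr (`|\det _| <= _).
  by apply/matrixP => i j; rewrite !mxE.
- have := Bb K J; congr (`|\det _| <= _).
  by apply/matrixP => i j; rewrite !mxE.
Qed.

Lemma minors_le_scale k M N (A : 'M[R]_(M, N)) (l a : R) :
  minors_le k A a -> minors_le k (l *: A) (`|l| ^+ k * a).
Proof.
move=> Aa I J; have -> : mxsub (val I) (val J) (l *: A) =
    l *: mxsub (val I) (val J) A by apply/matrixP => i j; rewrite !mxE.
by rewrite detZ normrM normrX ler_wpM2l ?exprn_ge0.
Qed.

Fact multi_index_lift_subproof k N (I : multi_index k.+1 N) (i : 'I_k.+1) :
  [forall a : 'I_k, forall b : 'I_k, (a < b)%N ==>
     ([ffun a => val I (lift i a)] a < [ffun a => val I (lift i a)] b)%N].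
Proof.
apply/forallP => a; apply/forallP => b; apply/implyP => ab; rewrite !ffunE.
by apply: multi_index_lt; rewrite /= ltnNge leq_bump2 -ltnNge.
Qed.

Definition multi_index_lift k N (I : multi_index k.+1 N) (i : 'I_k.+1) :
  multi_index k N := @exist {ffun 'I_k -> 'I_N} _ _ (multi_index_lift_subproof I i).


(** The entries of the adjugate are, up to sign, minors of order [k], and its determinant is
    [\det B ^+ k]. The case of a zero determinant is set apart because this identity is obtained by
    cancelling [\det B]. *)
Lemma minor_succ_le k M N (A : 'M[R]_(M, N)) (e : R)
    (I : multi_index k.+1 M) (J : multi_index k.+1 N) :
  0 <= e -> minors_le k A e ->
  `|\det (mxsub (val I) (val J) A)| ^+ k <= k.+1`!%:R * e ^+ k.+1 \/
  \det (mxsub (val I) (val J) A) = 0.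
Proof.
move=> e0 Ae; set B := mxsub _ _ _.
have [B0|B0] := eqVneq (\det B) 0; [by right|left].
have <- : `|\det (\adj B)| = `|\det B| ^+ k.
  rewrite -normrX; congr `|_|; apply: (mulfI B0).
  by rewrite -det_mulmx mul_mx_adj det_scalar exprS.
apply: det_le => i j; rewrite mxE /cofactor normrM normrX normrN1 expr1n mul1r.
have := Ae (multi_index_lift I j) (multi_index_lift J i).
congr (`|\det _| <= _).
by apply/matrixP => a b; rewrite !mxE !ffunE.
Qed.

(** The previous estimate reads |det|^(k+1) <= ((k+2)! e) e^(k+1). The bound on [e] makes the first
    factor at most 1, and a root of order [k.+1] is taken. *)
Lemma minors_le_succ k M N (A : 'M[R]_(M, N)) (e eta : R) :
  0 <= e -> e <= eta -> e <= k.+2`!%:R^-1 ->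
  minors_le k.+1 A e -> minors_le k.+2 A eta.
Proof.
move=> e0 eeta ek Ae I J.
have [h|->] := minor_succ_le I J e0 Ae; last by rewrite normr0 (le_trans e0 eeta).
rewrite -(@ler_pXn2r _ k.+1) ?nnegrE ?(le_trans e0 eeta) //; apply: le_trans h _.
rewrite exprS mulrA -[leRHS]mul1r.
apply: ler_pM => //; rewrite ?mulr_ge0 ?exprn_ge0 //.
  by rewrite mulrC -ler_pdivlMr ?ltr0n ?fact_gt0 // mul1r.
by apply: lerXn2r; rewrite ?nnegrE ?(le_trans e0 eeta).
Qed.

End minors.

(** * Euclidean norm and points of the sphere *)

Section l2norm.
Context {R : realType}.

Lemma l2norm_ge0 (I : finType) (w : I -> R) : 0 <= l2norm w.
Proof. exact: sqrtr_ge0. Qed.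

Lemma l2norm_sqr (I : finType) (w : I -> R) : l2norm w ^+ 2 = \sum_i w i ^+ 2.
Proof. by rewrite sqr_sqrtr // sumr_ge0 // => i _; exact: sqr_ge0. Qed.

Lemma ler_l2norm (I : finType) (w : I -> R) i : `|w i| <= l2norm w.
Proof.
rewrite -sqrtr_sqr ler_wsqrtr // (bigD1 i) //= lerDl.
by apply: sumr_ge0 => j _; exact: sqr_ge0.
Qed.

Lemma l2norm_le_sum (I : finType) (w : I -> R) : l2norm w <= \sum_i `|w i|.
Proof.
have S0 : 0 <= \sum_i `|w i| by exact: sumr_ge0.
rewrite -(ger0_norm S0) -sqrtr_sqr ler_wsqrtr // expr2 mulr_suml.
apply: ler_sum => i _; rewrite -normr_id -real_normK ?num_real // normr_id expr2.
rewrite ler_wpM2l // (bigD1 i) //= lerDl.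
exact: sumr_ge0.
Qed.

Lemma l2normZ n (a : R) (x : 'rV[R]_n) :
  l2norm ((a *: x) ord0) = `|a| * l2norm (x ord0).
Proof.
rewrite /l2norm -sqrtr_sqr -sqrtrM ?sqr_ge0 // mulr_sumr; congr Num.sqrt.
by apply: eq_bigr => i _; rewrite mxE exprMn.
Qed.

Lemma l2norm_eq0 n (x : 'rV[R]_n) : (l2norm (x ord0) == 0) = (x == 0).
Proof.
apply/eqP/eqP => [x0|->]; last first.
  by rewrite /l2norm big1 ?sqrtr0 // => i _; rewrite mxE expr0n.
apply/rowP => i; rewrite mxE; apply/eqP; rewrite -normr_le0 -x0.
exact: ler_l2norm.
Qed.

Lemma l2norm_gt0 n (x : 'rV[R]_n) : (0 < l2norm (x ord0)) = (x != 0).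
Proof. by rewrite lt0r l2norm_eq0 l2norm_ge0 andbT. Qed.

Lemma sphereP n (x : 'rV[R]_n.+1) : sphere R n x <-> \sum_i x ord0 i ^+ 2 = 1.
Proof.
rewrite -l2norm_sqr; split=> [->|]; first by rewrite expr1n.
by move/eqP; rewrite sqrp_eq1 ?l2norm_ge0 // => /eqP.
Qed.

Lemma sphere_neq0 n (x : 'rV[R]_n.+1) : sphere R n x -> x != 0.
Proof. by rewrite -l2norm_gt0 => ->. Qed.

Lemma sphere_coord_le1 n (x : 'rV[R]_n.+1) i : sphere R n x -> `|x ord0 i| <= 1.
Proof. by move=> <-; exact: ler_l2norm. Qed.

End l2norm.

(** * Radial extensions and their differentials *)

Section radial_ext.
Context {R : realType} {m n : nat}.
Implicit Types (f : 'rV[R]_m.+1 -> 'rV[R]_n.+1) (x : 'rV[R]_m.+1).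

Lemma radial_ext_scale f x (l : R) : 0 < l -> radial_ext f (l *: x) = radial_ext f x.
Proof.
move=> l0; rewrite /radial_ext l2normZ gtr0_norm // invfM scalerA.
by rewrite -mulrA mulrCA mulVf ?mulr1 ?gt_eqF.
Qed.

Lemma radial_ext_sphere f x : sphere R m x -> radial_ext f x = f x.
Proof. by rewrite /radial_ext => ->; rewrite invr1 scale1r. Qed.

Lemma sphere_normalize x : x != 0 -> sphere R m ((l2norm (x ord0))^-1 *: x).
Proof.
move=> x0; rewrite /sphere /= l2normZ ger0_norm ?invr_ge0 ?l2norm_ge0 //.
by rewrite mulVf // l2norm_eq0.
Qed.

(* [radial_ext f] is constant along the ray through x. *)
Lemma diff_radial_ext_self f x : differentiable (radial_ext f) x ->
  'd (radial_ext f) x x = 0.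
Proof.
move=> df; rewrite -deriveE //; apply: cvg_lim; first exact: norm_hausdorff.
apply: cvg_near_cst; near=> h.
have -> : (radial_ext f \o shift x) (h *: x) = radial_ext f x.
  have h1 : `|h| < 1.
    near: h; apply: nbhs_dnbhs; exact: (@nbhs0_lt _ R^o).
  rewrite /= -[X in _ + X]scale1r -scalerDl radial_ext_scale //.
  by have := ler_norm (- h); rewrite normrN; lra.
by rewrite subrr scaler0.
Unshelve. all: by end_near. Qed.

(** A function that is positively homogeneous of degree 0 has a differential of degree -1. *)
Lemma diff_radial_ext_scale f x (l : R) v : 0 < l ->
  differentiable (radial_ext f) x -> differentiable (radial_ext f) (l *: x) ->
  'd (radial_ext f) (l *: x) v = l^-1 *: 'd (radial_ext f) x v.
Proof.
move=> l0 dx dlx.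
have e : radial_ext f = radial_ext f \o ( *:%R l).
  by apply/funext => y; rewrite /= radial_ext_scale.
have ds : differentiable ( *:%R l : 'rV[R]_m.+1 -> 'rV[R]_m.+1) x.
  by have [] := is_diff_scaler (V := 'rV[R]_m.+1) l x.
have h w : 'd (radial_ext f) x w = 'd (radial_ext f) (l *: x) (l *: w).
  have <- : 'd ( *:%R l : 'rV[R]_m.+1 -> 'rV[R]_m.+1) x w = l *: w.
    by have [_ ->] := is_diff_scaler (V := 'rV[R]_m.+1) l x.
  exact: etrans (f_equal (fun F => 'd F x w) e)
    (f_equal (fun L : 'rV[R]_m.+1 -> 'rV[R]_n.+1 => L w) (diff_comp ds dlx)).
have lK (L : {linear 'rV[R]_m.+1 -> 'rV[R]_n.+1}) w : l^-1 *: L (l *: w) = L w.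
  by rewrite linearZ /= scalerA mulVf ?gt_eqF // scale1r.
exact/esym/(etrans (f_equal ( *:%R l^-1) (h v)))/lK.
Qed.

End radial_ext.

(** * Comparison of the dilation with the minors of the Jacobian *)

Section dilation_minors.
Context {R : realType}.

(** Lambda^k L sends v_1 /\ ... /\ v_k to L v_1 /\ ... /\ L v_k; in coordinates this is the
    Cauchy-Binet formula. *)
Lemma ext_power_map_wedge k M N (L : {linear 'rV[R]_M -> 'rV[R]_N})
    (V : 'M[R]_(k, M)) :
  ext_power_map L (wedge_rows V) = wedge_rows (V *m lin1_mx L).
Proof.
apply/ffunP => J; rewrite !ffunE.
rewrite (_ : \matrix_(i, j) _ = V *m colsub (val J) (lin1_mx L)); last first.
  by apply/matrixP => i j; rewrite !mxE; apply: eq_bigr => l _; rewrite !mxE.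
rewrite det_mulmx_rect; apply: eq_bigr => I _; rewrite !ffunE.
congr (\det _ * \det _); apply/matrixP => i j; rewrite !mxE //.
Qed.

Lemma wedge_rowsE k M N (L : 'rV[R]_M -> 'rV[R]_N) (I : multi_index k M)
    (J : multi_index k N) :
  wedge_rows (\matrix_(i < k) L (delta_mx ord0 (val I i))) J =
  \det (mxsub (val I) (val J) (lin1_mx L)).
Proof.
by rewrite ffunE; congr (\det _); apply/matrixP => i j; rewrite !mxE.
Qed.

(** The estimate is made on the whole unit ball of Lambda^k R^(m+1): coordinates of [w] are at most
    1, entries of the exterior power at most [c], and the two cardinals count the terms. *)
Lemma dilation_le_minors k m n (f : 'rV[R]_m.+1 -> 'rV[R]_n.+1) (c : R) :
  (forall x, sphere R m x -> minors_le k ('J (radial_ext f) x) c) -> 0 <= c ->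
  (dilation k f <=
   (#|multi_index k n.+1|%:R * (#|multi_index k m.+1|%:R * c))%:E)%E.
Proof.
move=> fc c0; apply: ub_ereal_sup => _ [x xS <-].
apply: ub_ereal_sup => _ [w [_ w1] <-]; rewrite lee_fin.
apply: le_trans (l2norm_le_sum _) _; rewrite mulr_natl -sumr_const.
apply: ler_sum => J _; rewrite ffunE; apply: le_trans (ler_norm_sum _ _ _) _.
rewrite mulr_natl -sumr_const; apply: ler_sum => I _.
rewrite wedge_rowsE normrM -[leRHS]mul1r; apply: ler_pM => //.
  exact: le_trans (ler_l2norm _ _) w1.
exact: fc.
Qed.

Lemma tangent_projection m (x v : 'rV[R]_m.+1) : sphere R m x ->
  tangent_vector x (v - (v *m x^T) ord0 ord0 *: x).
Proof.
move=> /sphereP xS; apply/matrixP => i j; rewrite !ord1 mulmxBl -scalemxAl !mxE.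
rewrite (_ : \sum_j0 x ord0 j0 * x^T j0 ord0 = 1) ?mulr1 ?subrr //.
by rewrite -[RHS]xS; apply: eq_bigr => l _; rewrite mxE expr2.
Qed.

(** A minor involves the basis vectors e_(I i), which need not be tangent at [x]. Projecting them
    onto the orthogonal complement of [x] does not change their images, because the differential of
    the radial extension kills [x]. The wedge of the projections, rescaled into the unit ball, then
    tests the operator norm. *)
Lemma minors_le_dilation k m : exists2 C : R, 0 < C &
  forall n (f : 'rV[R]_m.+1 -> 'rV[R]_n.+1) (d : R) x, C1_sphere_map f ->
    (dilation k.+1 f < d%:E)%E -> sphere R m x ->
    minors_le k.+1 ('J (radial_ext f) x) (C * d).
Proof.
set p := #|multi_index k.+1 m.+1|.
(* Chosen so that (k+1)! e = 1 / (p + 1), which stays below 1 when summed over the [p] coordinates;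
   the successor keeps the divisor nonzero when there is no multi-index. *)
pose e : R := (k.+1`!%:R * p.+1%:R)^-1.
have e0 : 0 < e by rewrite invr_gt0 mulr_gt0 // ltr0n ?fact_gt0.
have e1 : e <= 1.
  by rewrite invf_le1 ?mulr_gt0 ?ltr0n ?fact_gt0 // -natrM ler1n muln_gt0 fact_gt0.
(* The projected basis vectors have coordinates at most 2, so the entries of [V] are at most [e]. *)
pose c := e / 2; have c0 : 0 < c by rewrite divr_gt0.
exists (c ^+ k.+1)^-1; first by rewrite invr_gt0 exprn_gt0.
move=> n f d x Cf fd xS I J; set L := 'd (radial_ext f) x.
pose P (i : 'I_k.+1) : 'rV[R]_m.+1 := delta_mx ord0 (val I i) -
  ((delta_mx ord0 (val I i) : 'rV[R]_m.+1) *m x^T) ord0 ord0 *: x.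
pose V := \matrix_(i < k.+1) (c *: P i).
have [_ df _] := Cf.
have LV : V *m lin1_mx L = c *: rowsub (val I) (lin1_mx L).
  apply/row_matrixP => i; rewrite row_mul rowK linearZ /= row_rowsub rowE.
  rewrite -scalemxAl; congr (_ *: _).
  rewrite !mul_rV_lin1 /P linearB linearZ /= [X in _ *: X]diff_radial_ext_self.
    by rewrite scaler0 subr0.
  exact/df/sphere_neq0.
have Vt : tangent_ext_power x (wedge_rows V).
  exists 1%N, (fun=> V); split=> [_ i|]; last first.
    by apply/ffunP => K; rewrite [RHS]ffunE big_ord1.
  by rewrite rowK /tangent_vector -scalemxAl tangent_projection // scaler0.
have V1 : l2norm (wedge_rows V) <= 1.
  apply: le_trans (l2norm_le_sum _) _.
  apply: (@le_trans _ _ (\sum_(K : multi_index k.+1 m.+1) k.+1`!%:R * e)).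
    apply: ler_sum => K _; rewrite ffunE.
    apply: (le_trans (@det_le _ _ _ e _)) => [i j|].
      rewrite mxE mxE mxE normrM (gtr0_norm c0).
      rewrite -[leRHS](@divfK _ 2) // ler_wpM2l ?(ltW c0) // /P.
      rewrite !mxE (bigD1 (val I i)) //= big1 => [|l li]; last first.
        by rewrite !mxE (negbTE li) andbF mul0r.
      rewrite !mxE !eqxx mul1r addr0; apply: le_trans (ler_normB _ _) _.
      have -> : 2 = 1 + 1 :> R by ring.
      apply: lerD; first by case: eqP; rewrite ?normr1 ?normr0.
      by rewrite normrM -[leRHS]mul1r ler_pM // sphere_coord_le1.
    rewrite ler_wpM2l // exprS -[leRHS]mulr1 ler_wpM2l ?(ltW e0) //.
    by rewrite exprn_ile1 // ltW.
  rewrite sumr_const -[_ *+ _]mulr_natl -/p /e invfM.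
  rewrite (mulrA k.+1`!%:R) divff ?mul1r; last by rewrite pnatr_eq0 -lt0n fact_gt0.
  by rewrite ler_pdivrMr ?ltr0n // mul1r ler_nat.
have := ext_power_map_wedge L V; rewrite LV => EV.
have h : l2norm (ext_power_map L (wedge_rows V)) < d.
  rewrite -lte_fin; apply: le_lt_trans fd; apply: ereal_sup_ge.
  exists (ext_power_diff_norm k.+1 f x); first by exists x.
  by apply: ereal_sup_ge; eexists; [exists (wedge_rows V); [|reflexivity]|].
rewrite ler_pdivlMl ?exprn_gt0 //; apply: le_trans (ltW h).
apply: le_trans (ler_l2norm _ J); rewrite EV ffunE.
rewrite (_ : \matrix_(i, j) _ = c *: mxsub (val I) (val J) (lin1_mx L)).
  by rewrite detZ normrM normrX (gtr0_norm c0).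
by apply/matrixP => i j; rewrite !mxE.
Qed.

End dilation_minors.

(** * Inclusion in the next class, and the neutral element *)

Section small_dilation.
Context {R : realType}.

Lemma dilation_lt_minors k m n (d : R) : 0 < d -> exists2 c : R, 0 < c &
  forall f : 'rV[R]_m.+1 -> 'rV[R]_n.+1,
    (forall x, sphere R m x -> minors_le k ('J (radial_ext f) x) c) ->
    (dilation k f < d%:E)%E.
Proof.
(* The successor makes the final inequality strict and [D] nonzero. *)
move=> d0; pose D : R := (#|multi_index k n.+1| * #|multi_index k m.+1|).+1%:R.
have D0 : 0 < D by rewrite ltr0n.
exists (d / D); first by rewrite divr_gt0.
move=> f fc; apply: (le_lt_trans (dilation_le_minors fc _)).
  by rewrite divr_ge0 ?ltW.
rewrite lte_fin mulrA -natrM mulrCA -[ltRHS]mulr1 ltr_pM2l //.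
by rewrite ltr_pdivrMr // mul1r ltr_nat.
Qed.

(** The same map serves for both orders, once its dilation of order [k.+1] is small enough for
    [minors_le_succ]. *)
Lemma small_dilation_classes_succ k m n :
  small_dilation_classes R k.+1 m n `<=` small_dilation_classes R k.+2 m n.
Proof.
move=> a aV d d0; have [c c0 cd] := dilation_lt_minors k.+2 m n d0.
have [C C0 Cm] := @minors_le_dilation R k m.
pose e : R := Num.min c k.+2`!%:R^-1.
have e0 : 0 < e by rewrite lt_min c0 invr_gt0 ltr0n fact_gt0.
have [|f [Cf fa fe]] := aV (e / C); first by rewrite divr_gt0.
exists f; split=> //; apply: cd => x xS.
apply: (@minors_le_succ _ _ _ _ _ e); rewrite ?(ltW e0) ?ge_min ?lexx ?orbT //.
by have := Cm _ _ _ _ Cf fe xS; rewrite mulrC divfK ?gt_eqF.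
Qed.

(** The order is positive here: the empty minor is 1. *)
Lemma minors_le0 k M N (c : R) : 0 <= c -> minors_le k.+1 (0 : 'M[R]_(M, N)) c.
Proof.
move=> c0 I J; rewrite (_ : mxsub _ _ _ = 0) ?det0 ?normr0 //.
by apply/matrixP => i j; rewrite !mxE.
Qed.

Lemma small_dilation_classes_one k m n :
  small_dilation_classes R k.+1 m.+1 n (homotopy_one R m (sphere_base R n)).
Proof.
move=> d d0; have [c c0 cd] := dilation_lt_minors k.+1 m.+1 n d0.
pose f := cst (val (sphere_base R n)) : 'rV[R]_m.+2 -> 'rV[R]_n.+1.
have ef : radial_ext f = cst (val (sphere_base R n)) by apply/funext.
exists f; split.
- split=> [x _|x _|x v _]; rewrite ?ef.
  + exact: set_mem (valP (sphere_base R n)).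
  + exact: differentiable_cst.
  + rewrite (_ : (fun y => _) = cst 0); first exact: cst_continuous.
    by apply/funext => y; rewrite diff_cst.
- by exists (cube_cst) => // t _; rewrite cube_cstE.
- apply: cd => x _; rewrite (_ : 'J _ _ = 0) ?ef; first exact/minors_le0/ltW.
  by apply/matrixP => i j; rewrite !mxE diff_cst mxE.
Qed.

End small_dilation.

(** * C^1 maps off the origin *)

Section differential_calculus.
Context {R : realType}.

Lemma is_diff_bigsum (V W : normedModType R) (I : Type) (r : seq I)
    (F dF : I -> V -> W) (x : V) :
  (forall i, is_diff x (F i) (dF i)) ->
  is_diff x (fun y => \sum_(i <- r) F i y) (fun v => \sum_(i <- r) dF i v).
Proof.
move=> FdF; elim: r => [|i r IH].
  have e (G : I -> V -> W) : (fun y => \sum_(i <- [::]) G i y) = cst 0.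
    by apply/funext => y; rewrite big_nil.
  by rewrite !e; exact: is_diff_cst.
have e (G : I -> V -> W) : (fun y => \sum_(j <- i :: r) G j y) =
    G i + (fun y => \sum_(j <- r) G j y).
  by apply/funext => y; rewrite big_cons.
by rewrite !e; exact: is_diffD.
Qed.

Lemma is_diff_row (V : normedModType R) n (F dF : 'I_n.+1 -> V -> R) (x : V) :
  (forall j, is_diff x (F j) (dF j)) ->
  is_diff x (fun y => \row_j F j y) (fun v => \row_j dF j v).
Proof.
move=> FdF.
have rowE (G : 'I_n.+1 -> V -> R) : (fun y => \row_j G j y) =
    (fun y => \sum_j (G j y *: (delta_mx ord0 j : 'rV[R]_n.+1))).
  by apply/funext => y; rewrite [LHS]row_sum_delta; apply: eq_bigr => j _; rewrite mxE.
rewrite !rowE; apply: is_diff_bigsum => j.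
have [dF1 dF2] := FdF j.
split; first exact: differentiableZl.
by rewrite diffZl // dF2.
Qed.

Lemma is_diff_coord n (j : 'I_n.+1) (x : 'rV[R]_n.+1) :
  is_diff x (fun y : 'rV[R]_n.+1 => y ord0 j) (fun v => v ord0 j).
Proof.
have cl : linear (fun y : 'rV[R]_n.+1 => y ord0 j : R^o).
  by move=> a u v; rewrite !mxE.
pose clM := GRing.isLinear.Build _ _ _ _ _ cl.
pose L : {linear 'rV[R]_n.+1 -> R^o} := HB.pack (fun y : 'rV[R]_n.+1 => y ord0 j) clM.
have cL : continuous L by exact: coord_continuous.
split; first exact: differentiable_coord.
exact: (diff_lin x cL).
Qed.

Lemma linear_row_sum a b (L : {linear 'rV[R]_a -> 'rV[R]_b}) (w : 'rV[R]_a) :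
  L w = \sum_j w ord0 j *: L (delta_mx ord0 j).
Proof.
rewrite [in LHS](row_sum_delta w) linear_sum; apply: eq_bigr => j _.
by rewrite linearZ.
Qed.

Lemma near_neq0 a (x : 'rV[R]_a.+1) : x != 0 -> \forall y \near x, y != 0.
Proof. by move=> x0; exact: (@cvgr_neq0 _ _ _ (nbhs x) _ id x cvg_id x0). Qed.

Lemma cvg_bigsum (T : Type) (F : set_system T) (FF : Filter F)
    (V : normedModType R) (I : Type) (r : seq I) (f : I -> T -> V) (l : I -> V) :
  (forall i, f i @ F --> l i) ->
  (fun t => \sum_(i <- r) f i t) @ F --> \sum_(i <- r) l i.
Proof.
move=> fl; elim: r => [|i r IH].
  rewrite big_nil; have -> : (fun t => \sum_(i <- [::]) f i t) = cst 0.
    by apply/funext => t; rewrite big_nil.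
  exact: cvg_cst.
rewrite big_cons; have -> : (fun t => \sum_(j <- i :: r) f j t) =
    f i + (fun t => \sum_(j <- r) f j t).
  by apply/funext => t; rewrite big_cons.
exact: cvgD.
Qed.

Lemma near_eq_continuous (T U : topologicalType) (f g : T -> U) (x : T) :
  (\forall y \near x, g y = f y) -> {for x, continuous g} ->
  {for x, continuous f}.
Proof.
move=> gf cg; rewrite /prop_for /continuous_at -(nbhs_singleton gf).
exact: (cvg_trans (near_eq_cvg gf)).
Qed.

Definition C1_off0 a b (F : 'rV[R]_a.+1 -> 'rV[R]_b.+1) : Prop :=
  forall x, x != 0 -> differentiable F x /\
    forall v, {for x, continuous (fun y => 'd F y v)}.

Lemma diff_comp_at a b c (F : 'rV[R]_b.+1 -> 'rV[R]_c.+1)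
    (Phi DPhi : 'rV[R]_a.+1 -> 'rV[R]_b.+1) y :
  is_diff y Phi DPhi -> differentiable F (Phi y) ->
  forall v, 'd (F \o Phi) y v = 'd F (Phi y) (DPhi v).
Proof.
move=> [dP eP] dF v.
have <- : 'd Phi y v = DPhi v by exact: (f_equal (fun L => L v) eP).
exact: (f_equal (fun L : 'rV[R]_a.+1 -> 'rV[R]_c.+1 => L v) (diff_comp dP dF)).
Qed.

(** [C1_off0] gives continuity of the differential only at each fixed vector. The moving vector
    [DPhi y v] is therefore expanded in the standard basis, which leaves continuous coefficients
    times differentials at fixed vectors. *)
Lemma C1_off0_comp a b c (F : 'rV[R]_b.+1 -> 'rV[R]_c.+1)
    (Phi : 'rV[R]_a.+1 -> 'rV[R]_b.+1)
    (DPhi : 'rV[R]_a.+1 -> 'rV[R]_a.+1 -> 'rV[R]_b.+1) :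
  (forall y, is_diff y Phi (DPhi y)) -> (forall v, continuous (DPhi ^~ v)) ->
  (forall y, y != 0 -> Phi y != 0) -> C1_off0 F -> C1_off0 (F \o Phi).
Proof.
move=> dP cP P0 CF x x0; have [dF cF] := CF _ (P0 _ x0); split.
  by have [? _] := dP x; exact: differentiable_comp.
move=> v.
have cPhi : Phi y @[y --> x] --> Phi x.
  by have [? _] := dP x; exact: differentiable_continuous.
have E y : y != 0 -> 'd (F \o Phi) y v =
    \sum_j (DPhi y v) ord0 j *: 'd F (Phi y) (delta_mx ord0 j).
  move=> y0; exact: (etrans (diff_comp_at (dP y) (proj1 (CF _ (P0 _ y0))) v)
    (linear_row_sum _ _)).
apply: near_eq_continuous.
  by apply: filterS (near_neq0 x0) => y y0; exact: (esym (E y y0)).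
apply: (@cvg_bigsum _ (nbhs x) _) => j; apply: cvgZ.
  apply: (@continuous_comp _ _ _ (fun y => DPhi y v)
    (fun w : 'rV[R]_b.+1 => w ord0 j)); first exact: cP.
  exact: coord_continuous.
exact: (@continuous_comp _ _ _ Phi (fun z => 'd F z (delta_mx ord0 j))).
Qed.

Lemma C1_off0_add_cst a b (F G : 'rV[R]_a.+1 -> 'rV[R]_b.+1) (w : 'rV[R]_b.+1) :
  C1_off0 F -> C1_off0 G -> C1_off0 (fun x => F x + G x - w) /\
  forall x v, x != 0 -> 'd (fun x => F x + G x - w) x v = 'd F x v + 'd G x v.
Proof.
move=> CF CG.
have D x : x != 0 -> is_diff x (fun x => F x + G x - w) ('d F x \+ 'd G x).
  move=> x0; have [dF _] := CF x x0; have [dG _] := CG x x0.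
  have := is_diffB (is_diffD (differentiableP dF) (differentiableP dG))
    (is_diff_cst w x).
  by rewrite subr0.
have DE x v : x != 0 -> 'd (fun x => F x + G x - w) x v = 'd F x v + 'd G x v.
  by move=> x0; have [_ e] := D x x0; exact: (f_equal (fun L => L v) e).
split; last exact: DE.
move=> x x0; split; first by have [] := D x x0.
move=> v; have [_ cF] := CF x x0; have [_ cG] := CG x x0.
apply: near_eq_continuous.
  by apply: filterS (near_neq0 x0) => y y0; exact: (esym (DE y v y0)).
exact: (cvgD (cF v) (cG v)).
Qed.

End differential_calculus.

(** * Precomposition with a positively homogeneous map *)

Section precomposition.
Context {R : realType} {m n d : nat}.
Variables (f : 'rV[R]_m.+1 -> 'rV[R]_n.+1).
Variables (Phi : 'rV[R]_m.+1 -> 'rV[R]_m.+1).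
Variables (DPhi : 'rV[R]_m.+1 -> 'rV[R]_m.+1 -> 'rV[R]_m.+1).
Hypothesis Phi_diff : forall x, is_diff x Phi (DPhi x).
Hypothesis DPhi_continuous : forall v, continuous (DPhi ^~ v).
Hypothesis Phi_neq0 : forall x, x != 0 -> Phi x != 0.
Hypothesis Phi_homogeneous : forall l x, 0 < l -> Phi (l *: x) = l ^+ d *: Phi x.
Hypothesis fC1 : C1_sphere_map f.

Lemma C1_sphere_map_off0 : C1_off0 (radial_ext f).
Proof. by have [_ df cf] := fC1; move=> x x0; split; [exact: df|move=> v; exact: cf]. Qed.

Lemma C1_off0_precomp : C1_off0 (radial_ext f \o Phi).
Proof. exact: (C1_off0_comp Phi_diff DPhi_continuous Phi_neq0 C1_sphere_map_off0). Qed.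

(** The composite is homogeneous of degree 0, hence is its own radial extension: its calculus on the
    sphere can be done on the formula itself. *)
Lemma radial_ext_precomp : radial_ext (radial_ext f \o Phi) = radial_ext f \o Phi.
Proof.
apply/funext => x; rewrite /radial_ext /=.
have [->|x0] := eqVneq x 0; first by rewrite scaler0.
have r0 : 0 < (l2norm (x ord0))^-1 by rewrite invr_gt0 l2norm_gt0.
by rewrite Phi_homogeneous // -!/(radial_ext f _) radial_ext_scale ?exprn_gt0.
Qed.

Lemma radial_ext_in_sphere x : x != 0 -> sphere R n (radial_ext f x).
Proof. by have [fS _ _] := fC1; move=> x0; exact/fS/sphere_normalize. Qed.

(** The chain rule evaluates the Jacobian of [radial_ext f] at [Phi x], off the sphere. Moving this
    point to the sphere, where the minors are controlled, costs the factor in front, by homogeneity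
    of degree -1. *)
Lemma jacobian_precomp x : x != 0 ->
  'J (radial_ext f \o Phi) x =
  (l2norm (Phi x ord0))^-1 *:
    (lin1_mx (DPhi x) *m 'J (radial_ext f) ((l2norm (Phi x ord0))^-1 *: Phi x)).
Proof.
move=> x0; have P0 := Phi_neq0 x0; set r := l2norm _.
have r0 : 0 < r by rewrite l2norm_gt0.
have r'0 : 0 < r^-1 by rewrite invr_gt0.
have y0 : r^-1 *: Phi x != 0 by rewrite scaler_eq0 invr_eq0 gt_eqF.
have [_ df _] := fC1; have dP := df _ P0; have dy := df _ y0.
have E v : 'd (radial_ext f \o Phi) x v =
    r^-1 *: 'd (radial_ext f) (r^-1 *: Phi x) (DPhi x v).
  apply: (etrans (diff_comp_at (Phi_diff x) dP v)).
  have h := diff_radial_ext_scale (DPhi x v) r'0 dP dy.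
  have K (X : 'rV[R]_n.+1) : r^-1 *: (r^-1^-1 *: X) = X.
    by rewrite invrK scalerA mulVf ?gt_eqF // scale1r.
  exact: (esym (etrans (f_equal ( *:%R r^-1) h) (K _))).
have EJ (L : {linear 'rV[R]_m.+1 -> 'rV[R]_n.+1}) v j :
    L v ord0 j = \sum_l v ord0 l * lin1_mx L l j.
  by rewrite linear_row_sum summxE; apply: eq_bigr => l _; rewrite !mxE.
apply/matrixP => i j; rewrite [LHS]mxE (f_equal (fun w : 'rV_n.+1 => w ord0 j) (E _)).
rewrite mxE [RHS]mxE; congr (_ * _).
rewrite [RHS]mxE; apply: (etrans (EJ _ _ _)).
by apply: eq_bigr => l _; rewrite [in RHS]mxE.
Qed.

Lemma minors_le_precomp k (e B c : R) x :
  0 < e -> 0 <= B -> 0 <= c -> x != 0 -> e <= l2norm (Phi x ord0) ->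
  (forall i j, `|DPhi x (delta_mx ord0 i) ord0 j| <= B) ->
  (forall y, sphere R m y -> minors_le k ('J (radial_ext f) y) c) ->
  minors_le k ('J (radial_ext f \o Phi) x)
    (e^-1 ^+ k * (#|multi_index k m.+1|%:R * (k`!%:R * B ^+ k * c))).
Proof.
move=> e0 B0 c0 x0 ePhi DB fc I J.
have r0 : 0 < l2norm (Phi x ord0) by rewrite l2norm_gt0 Phi_neq0.
rewrite jacobian_precomp //.
have DPhiB i j : `|lin1_mx (DPhi x) i j| <= B by rewrite mxE.
have Fc := fc _ (sphere_normalize (Phi_neq0 x0)).
have := minors_le_scale (l2norm (Phi x ord0))^-1
  (minors_le_mulmx (minors_le_entries (k := k) DPhiB) Fc).
move=> /(_ I J) h; apply: le_trans h _.
rewrite ler_wpM2r ?mulr_ge0 ?exprn_ge0 //.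
rewrite lerXn2r ?nnegrE ?invr_ge0 ?(ltW e0) //.
by rewrite ger0_norm ?invr_ge0 ?(ltW r0) // lef_pV2.
Qed.

(** Motion of [Phi x] along its own ray is invisible to a radial extension. *)
Lemma diff_precomp_ray x (l : R) v : x != 0 -> DPhi x v = l *: Phi x ->
  'd (radial_ext f \o Phi) x v = 0.
Proof.
move=> x0 Dv; have [_ df _] := fC1; have dP := df _ (Phi_neq0 x0).
apply: (etrans (diff_comp_at (Phi_diff x) dP v)); rewrite Dv.
have K (L : {linear 'rV[R]_m.+1 -> 'rV[R]_n.+1}) w : L w = 0 -> L (l *: w) = 0.
  by move=> e; rewrite linearZ /= e scaler0.
exact/K/diff_radial_ext_self.
Qed.

End precomposition.

(** * The doubling map *)

Section doubling.
Context {R : realType}.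

(** The square of the negative part joins the zero function in a C^1 way at 0. *)
Definition sqr_neg (z : R) : R := Num.min z 0 ^+ 2.

Lemma sqr_neg_taylor z h :
  `|sqr_neg (z + h) - sqr_neg z - 2 * Num.min z 0 * h| <= h ^+ 2.
Proof.
rewrite /sqr_neg !minElt ler_norml.
case: ifP => h1; case: ifP => h2; apply/andP; split; nra.
Qed.

Lemma is_diff_sqr_neg z : is_diff z sqr_neg (fun h => 2 * Num.min z 0 * h).
Proof.
have c : h^-1 *: ((sqr_neg \o shift z) (h *: (1 : R^o)) - sqr_neg z) @[h --> 0^'] -->
    (2 * Num.min z 0 : R^o).
  apply/cvgrPdist_le => e e0; near=> h.
  have h0 : h != 0 by near: h; exact: nbhs_dnbhs_neq.
  have he : `|h| <= e.
    apply: ltW; near: h; apply: nbhs_dnbhs; exact: (@nbhs0_lt _ R^o).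
  rewrite /= [h *: 1]mulr1 [h + z]addrC -normrN opprB.
  have -> : h^-1 *: (sqr_neg (z + h) - sqr_neg z) - 2 * Num.min z 0 =
      h^-1 * (sqr_neg (z + h) - sqr_neg z - 2 * Num.min z 0 * h).
    rewrite [_ *: _](_ : _ = h^-1 * (sqr_neg (z + h) - sqr_neg z)) //.
    by field.
  rewrite normrM normfV ler_pdivrMl ?normr_gt0 //.
  apply: le_trans (sqr_neg_taylor _ _) _.
  by rewrite -real_normK ?num_real // expr2 ler_wpM2l.
have d1 : derivable sqr_neg z 1 by apply: cvgP c.
split; first exact: (proj1 (derivable1_diffP _ _) d1).
apply/funext => h; rewrite deriv1E // derive1E.
have -> : 'D_1 sqr_neg z = 2 * Num.min z 0 by apply: cvg_lim c; exact: norm_hausdorff.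
exact: mulrC.
Unshelve. all: by end_near. Qed.


Context {m : nat}.
Implicit Types x v : 'rV[R]_m.+2.

(** Coordinate 0 of the sphere is the axis of the base point and the others correspond, shifted by
    one, to those of the cube. Thus [axis1] matches the first coordinate of the cube, along which
    cubes are concatenated. *)
Definition axis1 : 'I_m.+2 := lift ord0 ord0.

(** The reflection of the sphere that corresponds to the reversal of cubes in [cube_inv]. *)
Definition flip x : 'rV[R]_m.+2 :=
  \row_j (if j == axis1 then - x ord0 j else x ord0 j).

(* [quarter_turn] is the orthogonal projection along the axis [axis1], followed
   by the rotation that sends - [ord0] to [axis1]. *)
Definition quarter_turn x (j : 'I_m.+2) : R :=
  if j == axis1 then - x ord0 ord0 else x ord0 j.

Definition sqn x : R := \sum_i x ord0 i ^+ 2.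

Definition cap x : R := sqr_neg (x ord0 axis1).

Definition cutoff x : R := - (x ord0 axis1 * cap x).

(* Only the direction of [doubling x] matters. The factor [cutoff x], the cube of
   the negative part of [x axis1], makes it C^1 where the sphere starts to be
   collapsed; homogeneity, of degree 4, spares the normalization of x. *)
Definition doubling x : 'rV[R]_m.+2 :=
  \row_j (if j == ord0 then sqn x ^+ 2 - 2 * cap x ^+ 2
          else cutoff x * quarter_turn x j).

Definition dsqn x v : R := \sum_i 2 * (x ord0 i * v ord0 i).
Definition dcap x v : R := 2 * Num.min (x ord0 axis1) 0 * v ord0 axis1.
Definition dcutoff x v : R := - (x ord0 axis1 * dcap x v + cap x * v ord0 axis1).

Definition ddoubling x v : 'rV[R]_m.+2 :=
  \row_j (if j == ord0 then 2 * sqn x * dsqn x v - 4 * (cap x * dcap x v)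
          else cutoff x * quarter_turn v j + quarter_turn x j * dcutoff x v).

Lemma is_diff_doubling x : is_diff x doubling (ddoubling x).
Proof.
have dc j := is_diff_coord j x.
have dM (f g df dg : 'rV[R]_m.+2 -> R) : is_diff x f df -> is_diff x g dg ->
    is_diff x (fun y => f y * g y) (fun v => f x * dg v + g x * df v).
  by move=> hf hg; exact: is_diffM.
have dN (f df : 'rV[R]_m.+2 -> R) : is_diff x f df ->
    is_diff x (fun y => - f y) (fun v => - df v).
  by move=> hf; exact: is_diffN.
have dB (f g df dg : 'rV[R]_m.+2 -> R) : is_diff x f df -> is_diff x g dg ->
    is_diff x (fun y => f y - g y) (fun v => df v - dg v).
  by move=> hf hg; exact: is_diffB.
have dZ a (f df : 'rV[R]_m.+2 -> R) : is_diff x f df ->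
    is_diff x (fun y => a * f y) (fun v => a * df v).
  by move=> hf; exact: is_diffZ.
have dsq : is_diff x sqn (dsqn x).
  apply: (is_diff_eq (is_diff_bigsum (index_enum 'I_m.+2)
    (fun i => dM _ _ _ _ (dc i) (dc i)))).
  apply/funext => v; apply: eq_bigr => i _; ring.
have dca : is_diff x cap (dcap x).
  have := @is_diff_comp _ _ _ _ _ _ _ _ _ (dc axis1) (is_diff_sqr_neg (x ord0 axis1)).
  exact.
have dbu : is_diff x cutoff (dcutoff x) by exact: (dN _ _ (dM _ _ _ _ (dc axis1) dca)).
apply: (is_diff_row (F := fun j y => if j == ord0 then sqn y ^+ 2 - 2 * cap y ^+ 2
          else cutoff y * quarter_turn y j)
  (dF := fun j v => if j == ord0 then 2 * sqn x * dsqn x v - 4 * (cap x * dcap x v)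
          else cutoff x * quarter_turn v j + quarter_turn x j * dcutoff x v)) => j.
have [j0|j0] := eqVneq j ord0.
  apply: (is_diff_eq (dB _ _ _ _ (dM _ _ _ _ dsq dsq)
    (dZ 2 _ _ (dM _ _ _ _ dca dca)))).
  by apply/funext => v; ring.
have dq : is_diff x (quarter_turn^~ j) (quarter_turn^~ j).
  rewrite /quarter_turn; case: eqP => _; [exact: dN|exact: dc].
exact: (dM _ _ _ _ dbu dq).
Qed.

End doubling.

(** * Homogeneity, collapse and estimates for the doubling map *)

Section doubling_properties.
Context {R : realType} {m : nat}.
Implicit Types x v : 'rV[R]_m.+2.

Lemma big_ord_axis (F : 'I_m.+2 -> R) :
  \sum_i F i = F ord0 + F axis1 + \sum_i F (lift ord0 (lift ord0 i)).
Proof. by rewrite !big_ord_recl addrA. Qed.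

Lemma forall_axis (P : 'I_m.+2 -> Prop) : P ord0 -> P axis1 ->
  (forall i, P (lift ord0 (lift ord0 i))) -> forall j, P j.
Proof.
move=> P0 P1 P2 j; case: (unliftP ord0 j) => [i ->|-> //].
by case: (unliftP ord0 i) => [l ->|->].
Qed.

Lemma sqn_l2norm x : sqn x = l2norm (x ord0) ^+ 2.
Proof. by rewrite l2norm_sqr. Qed.

Lemma sqn_gt0 x : x != 0 -> 0 < sqn x.
Proof. by move=> x0; rewrite sqn_l2norm exprn_gt0 // l2norm_gt0. Qed.

Lemma sqn_sphere x : sphere R m.+1 x -> sqn x = 1.
Proof. by move/sphereP. Qed.

Lemma sphere_sqn x : sqn x = 1 -> sphere R m.+1 x.
Proof. by move/sphereP. Qed.

Lemma cap_right x : 0 <= x ord0 axis1 -> cap x = 0.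
Proof. by move=> x0; rewrite /cap /sqr_neg min_r // expr0n. Qed.

Lemma cap_left x : x ord0 axis1 <= 0 -> cap x = x ord0 axis1 ^+ 2.
Proof. by move=> x0; rewrite /cap /sqr_neg min_l. Qed.

Lemma sqnZ (l : R) x : sqn (l *: x) = l ^+ 2 * sqn x.
Proof. by rewrite /sqn mulr_sumr; apply: eq_bigr => i _; rewrite mxE exprMn. Qed.

Lemma capZ (l : R) x : 0 < l -> cap (l *: x) = l ^+ 2 * cap x.
Proof.
move=> l0; have [x0|/ltW x0] := leP 0 (x ord0 axis1).
  by rewrite !cap_right ?mulr0 // mxE mulr_ge0 // ltW.
by rewrite !cap_left ?mxE ?exprMn // mulr_ge0_le0 // ltW.
Qed.

Lemma doubling0E x : doubling x ord0 ord0 = sqn x ^+ 2 - 2 * cap x ^+ 2.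
Proof. by rewrite mxE eqxx. Qed.

Lemma doubling1E x : doubling x ord0 axis1 = - (cutoff x * x ord0 ord0).
Proof. by rewrite mxE /quarter_turn eqxx mulrN. Qed.

Lemma doubling2E x i : doubling x ord0 (lift ord0 (lift ord0 i)) =
  cutoff x * x ord0 (lift ord0 (lift ord0 i)).
Proof. by rewrite mxE. Qed.

Lemma doublingZ (l : R) x : 0 < l -> doubling (l *: x) = l ^+ 4 *: doubling x.
Proof.
move=> l0; apply/rowP; apply: forall_axis => [||i].
- by rewrite [RHS]mxE !doubling0E sqnZ capZ //; ring.
- by rewrite [RHS]mxE !doubling1E /cutoff capZ // !mxE; ring.
- by rewrite [RHS]mxE !doubling2E /cutoff capZ // !mxE; ring.
Qed.

Lemma doubling_right x : 0 <= x ord0 axis1 ->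
  doubling x = sqn x ^+ 2 *: delta_mx ord0 ord0.
Proof.
move=> x1; apply/rowP; apply: forall_axis => [||i].
- by rewrite doubling0E cap_right // !mxE !eqxx /=; ring.
- by rewrite doubling1E /cutoff cap_right // !mxE /=; ring.
- by rewrite doubling2E /cutoff cap_right // !mxE /=; ring.
Qed.

(** Where [cutoff x] is nonzero, a zero of [doubling] would lie on the line of [axis1]; there the
    first coordinate is z^4 - 2 z^4, which is nonzero. *)
Lemma doubling_neq0 x : x != 0 -> doubling x != 0.
Proof.
move=> x0; apply/eqP => D0.
have D j : doubling x ord0 j = 0 by rewrite D0 mxE.
have N0 := sqn_gt0 x0.
have [x1|x1] := leP 0 (x ord0 axis1).
  have := D ord0; rewrite doubling_right // !mxE !eqxx mulr1 => /eqP.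
  by rewrite sqrf_eq0 gt_eqF.
have q : cap x = x ord0 axis1 ^+ 2 by rewrite cap_left // ltW.
have b0 : cutoff x != 0.
  rewrite /cutoff q; apply: lt0r_neq0.
  by rewrite oppr_gt0 nmulr_rlt0 // exprn_even_gt0 //= lt_eqF.
have y0 : x ord0 ord0 = 0.
  by have /eqP := D axis1; rewrite doubling1E oppr_eq0 mulf_eq0 (negbTE b0) => /eqP.
have yi i : x ord0 (lift ord0 (lift ord0 i)) = 0.
  have /eqP := D (lift ord0 (lift ord0 i)).
  by rewrite doubling2E mulf_eq0 (negbTE b0) => /eqP.
have N : sqn x = x ord0 axis1 ^+ 2.
  rewrite /sqn big_ord_axis y0 big1 => [|i _]; last by rewrite yi expr0n.
  by ring.
have := D ord0; rewrite doubling0E N q.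
move: x1 {N q b0 D D0 y0 yi N0}; move: (x ord0 axis1) => z z0.
have : 0 < z ^+ 2 ^+ 2 by rewrite exprn_gt0 // exprn_even_gt0 //= lt_eqF.
lra.
Qed.

(** On the left half, with s the square of [x ord0 axis1], the squared norm is (1 - 2 s^2)^2 + s^3
    (1 - s), whose two terms have no common zero in [0, 1]. *)
Lemma l2norm_doubling_ge x : sphere R m.+1 x -> 10^-1 <= l2norm (doubling x ord0).
Proof.
move=> /sqn_sphere N1.
rewrite -(@ler_pXn2r _ 2) ?nnegrE ?l2norm_ge0 // l2norm_sqr big_ord_axis.
rewrite doubling0E doubling1E.
under eq_bigr do rewrite doubling2E exprMn.
rewrite -mulr_sumr N1.
have [x1|/ltW x1] := leP 0 (x ord0 axis1).
  by rewrite /cutoff cap_right //; nra.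
move: N1; rewrite /sqn big_ord_axis /cutoff cap_left //.
have : 0 <= \sum_i x ord0 (lift ord0 (lift ord0 i)) ^+ 2.
  by apply: sumr_ge0 => i _; exact: sqr_ge0.
move: x1; move: (x ord0 axis1) (x ord0 ord0) (\sum_i _) => z y S z0 S0 e.
have y2 : 0 <= y ^+ 2 by exact: sqr_ge0.
rewrite (_ : _ + _ = (1 - 2 * (z ^+ 2) ^+ 2) ^+ 2 + (z ^+ 2) ^+ 3 * (1 - z ^+ 2)).
  have : z ^+ 2 <= 1 by lra.
  have : 0 <= z ^+ 2 by exact: sqr_ge0.
  (* For s <= 2/5 the first term suffices, since 1 - 2 s^2 >= 17/25. *)
  move: (z ^+ 2) => s s0 s1; have [s4|s4] := leP s (2 / 5).
    have h : 0 <= s ^+ 3 * (1 - s) by rewrite mulr_ge0 ?exprn_ge0 // subr_ge0.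
    have h2 : s ^+ 2 <= (2 / 5) ^+ 2.
      by apply: lerXn2r; rewrite ?nnegrE // (le_trans s0).
    have h3 : (1 / 10) ^+ 2 <= (1 - 2 * s ^+ 2) ^+ 2.
      by apply: lerXn2r; rewrite ?nnegrE; lra.
    lra.
  (* The polynomial is 1 - 4 s^2 + s^3 + 3 s^4. Subtracting three times this square leaves a concave
     quadratic, larger than 1/100 at 2/5 and at 1, hence between them. *)
  have h1 := sqr_ge0 (s ^+ 2 + s / 6 - 3 / 5).
  have h2 : 0 <= (1 - s) * (s - 2 / 5) by rewrite mulr_ge0; lra.
  nra.
have -> : S = 1 - y ^+ 2 - z ^+ 2 by rewrite -e; ring.
ring.
Qed.

Lemma norm_mul2_le (a b : R) : `|2 * (a * b)| <= a ^+ 2 + b ^+ 2.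
Proof.
have h1 := sqr_ge0 (a - b); have h2 := sqr_ge0 (a + b).
by rewrite ler_norml; apply/andP; split; nra.
Qed.

(** The constant comes from coordinate 0, bounded by 2 * 2 + 4 * 2; the other coordinates are at
    most 1 + 3. *)
Lemma ddoubling_le x v i : sphere R m.+1 x -> sphere R m.+1 v ->
  `|ddoubling x v ord0 i| <= 12.
Proof.
move=> xS vS; have cx j := sphere_coord_le1 j xS; have cv j := sphere_coord_le1 j vS.
have N1 := sqn_sphere xS; have V1 := sqn_sphere vS.
have dN : `|dsqn x v| <= 2.
  apply: le_trans (ler_norm_sum _ _ _) _.
  rewrite [leRHS](_ : _ = sqn x + sqn v); last by rewrite N1 V1; ring.
  rewrite /sqn -big_split /=; apply: ler_sum => j _.
  exact: norm_mul2_le.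
have q0 : 0 <= cap x by exact: sqr_ge0.
have q1 : cap x <= 1.
  have [x1|/ltW x1] := leP 0 (x ord0 axis1); first by rewrite cap_right.
  by rewrite cap_left // -[leRHS](expr1n _ 2) -real_normK ?num_real // lerXn2r ?nnegrE.
have dq : `|dcap x v| <= 2.
  rewrite /dcap !normrM ger0_norm // -[leRHS]mulr1 ler_pM ?mulr_ge0 //.
  rewrite -[leRHS]mulr1 ler_pM // minElt; case: ifP => // _.
  by rewrite normr0.
have dc : `|dcutoff x v| <= 3.
  rewrite /dcutoff normrN; apply: le_trans (ler_normD _ _) _.
  rewrite (normrM (x _ _)) (normrM (cap x)) (ger0_norm q0).
  have -> : 3 = 1 * 2 + 1 * 1 :> R by ring.
  by apply: lerD; apply: ler_pM.
have c1 : `|cutoff x| <= 1.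
  rewrite /cutoff normrN (normrM (x _ _)) (ger0_norm q0) -[leRHS]mulr1.
  exact: ler_pM.
have rq w : sphere R m.+1 w -> `|quarter_turn w i| <= 1.
  move=> wS; rewrite /quarter_turn.
  by case: eqP => _; rewrite ?normrN; exact: sphere_coord_le1.
rewrite mxE; case: eqP => _; apply: le_trans (ler_normD _ _) _.
  rewrite normrN N1 mulr1 (normrM 2) (normrM 4) (normrM (cap x)) (ger0_norm q0).
  rewrite !normr_nat.
  have : cap x * `|dcap x v| <= 1 * 2 by apply: ler_pM.
  lra.
rewrite (normrM (cutoff x)) (normrM (quarter_turn x i)).
have : `|cutoff x| * `|quarter_turn v i| <= 1 * 1 by apply: ler_pM => //; exact: rq.
have : `|quarter_turn x i| * `|dcutoff x v| <= 1 * 3 by apply: ler_pM => //; exact: rq.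
lra.
Qed.

(** On this half, boundary included, [cap] and its differential vanish. What is left is the
    variation of the factor [sqn x ^+ 2] along a fixed ray; the coefficient is its logarithmic
    derivative. *)
Lemma ddoubling_right x v : x != 0 -> 0 <= x ord0 axis1 ->
  ddoubling x v = (2 * dsqn x v / sqn x) *: doubling x.
Proof.
move=> x0 x1; rewrite doubling_right // scalerA.
apply/rowP => j; rewrite !mxE /dcutoff /cutoff /dcap cap_right // min_r //.
case: eqP => _ /=; last by ring.
by field; rewrite gt_eqF ?sqn_gt0.
Qed.

Lemma ddoubling_continuous v : continuous (fun x => ddoubling x v).
Proof.
have C0 a : continuous (fun x : 'rV[R]_m.+2 => a : R).
  by move=> x; exact: (@cst_continuous _ R^o).
have cM (f g : 'rV[R]_m.+2 -> R) : continuous f -> continuous g ->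
    continuous (fun x => f x * g x).
  by move=> cf cg x; exact: (cvgM (cf x) (cg x)).
have cD (f g : 'rV[R]_m.+2 -> R) : continuous f -> continuous g ->
    continuous (fun x => f x + g x).
  by move=> cf cg x; exact: (@cvgD _ R^o _ _ _ _ _ _ _ (cf x) (cg x)).
have cN (f : 'rV[R]_m.+2 -> R) : continuous f -> continuous (fun x => - f x).
  by move=> cf x; exact: (@cvgN _ R^o _ _ _ _ _ (cf x)).
have cc j : continuous (fun x : 'rV[R]_m.+2 => x ord0 j) by exact: coord_continuous.
have csum (f : 'I_m.+2 -> 'rV[R]_m.+2 -> R) : (forall i, continuous (f i)) ->
    continuous (fun x => \sum_i f i x).
  by move=> cf x; exact: (@cvg_bigsum _ _ (nbhs x) _ R^o _ _ _ _ (fun i => cf i x)).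
have cN2 : continuous (@sqn R m) by apply: csum => i; exact: (cM _ _ (cc i) (cc i)).
have cmin : continuous (fun x : 'rV[R]_m.+2 => Num.min (x ord0 axis1) 0).
  move=> x; apply: continuous_min; [exact: cc|exact: C0].
have cq : continuous (@cap R m) by exact: (cM _ _ cmin cmin).
have cb : continuous (@cutoff R m) by exact: (cN _ (cM _ _ (cc _) cq)).
have cdN : continuous (fun x => dsqn x v).
  by apply: csum => i; exact: (cM _ _ (C0 2) (cM _ _ (cc i) (C0 _))).
have cdq : continuous (fun x => dcap x v) by exact: (cM _ _ (cM _ _ (C0 2) cmin) (C0 _)).
have cdb : continuous (fun x => dcutoff x v).
  exact: (cN _ (cD _ _ (cM _ _ (cc _) cdq) (cM _ _ cq (C0 _)))).
have ct j : continuous (fun x : 'rV[R]_m.+2 => quarter_turn x j).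
  by rewrite /quarter_turn; case: eqP => _; [exact: (cN _ (cc _))|exact: cc].
apply: mx_continuous => i j.
have [j0|j0] := eqVneq j ord0.
  rewrite (_ : (fun x => _) =
    (fun x => 2 * sqn x * dsqn x v - 4 * (cap x * dcap x v))).
    exact: (cD _ _ (cM _ _ (cM _ _ (C0 2) cN2) cdN)
      (cN _ (cM _ _ (C0 4) (cM _ _ cq cdq)))).
  by apply/funext => x; rewrite mxE j0.
rewrite (_ : (fun x => _) = (fun x =>
  cutoff x * quarter_turn v j + quarter_turn x j * dcutoff x v)).
  exact: (cD _ _ (cM _ _ cb (C0 _)) (cM _ _ (ct j) cdb)).
by apply/funext => x; rewrite mxE (negbTE j0).
Qed.

Lemma flipE x j : flip x ord0 j = if j == axis1 then - x ord0 j else x ord0 j.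
Proof. by rewrite mxE. Qed.

Lemma sqn_flip x : sqn (flip x) = sqn x.
Proof.
by apply: eq_bigr => i _; rewrite flipE; case: eqP => // _; rewrite sqrrN.
Qed.

Lemma sphere_flip x : sphere R m.+1 x -> sphere R m.+1 (flip x).
Proof. by move=> xS; apply: sphere_sqn; rewrite sqn_flip sqn_sphere. Qed.

Lemma flip_neq0 x : x != 0 -> flip x != 0.
Proof.
move=> x0; apply/eqP => e; have := sqn_gt0 x0.
by rewrite -sqn_flip e /sqn big1 ?ltxx // => i _; rewrite mxE expr0n.
Qed.

Lemma flipZ (l : R) x : flip (l *: x) = l *: flip x.
Proof. by apply/rowP => j; rewrite !mxE; case: eqP => // _; rewrite mulrN. Qed.

Lemma is_diff_flip x : is_diff x flip flip.
Proof.
have d j : is_diff x (fun y : 'rV[R]_m.+2 => if j == axis1 then - y ord0 j else y ord0 j)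
    (fun y => if j == axis1 then - y ord0 j else y ord0 j).
  by case: eqP => _; [exact: (is_diffN (is_diff_coord j x))|exact: is_diff_coord].
exact: (is_diff_row d).
Qed.

Lemma flip_continuous : continuous (@flip R m).
Proof.
by move=> x; apply: differentiable_continuous; have [] := is_diff_flip x.
Qed.

Lemma is_diff_doubling_flip x : is_diff x (doubling \o flip)
  (fun v => ddoubling (flip x) (flip v)).
Proof. exact: (is_diff_comp (is_diff_flip x) (is_diff_doubling (flip x))). Qed.

Lemma ddoubling_flip_continuous v :
  continuous (fun x => ddoubling (flip x) (flip v)).
Proof.
move=> x; apply: (@continuous_comp _ _ _ flip (fun y => ddoubling y (flip v))).
  exact: flip_continuous.
exact: ddoubling_continuous.
Qed.

End doubling_properties.

(** * The cube and the sphere *)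

Section cube_to_sphere.
Context {R : realType} {m : nat}.
Implicit Types t u : 'rV[R]_m.+1.
Local Notation base := (delta_mx ord0 ord0 : 'rV[R]_m.+2).

Lemma coord_le_norm n (u : 'rV[R]_n) i : `|u ord0 i| <= `|u|.
Proof.
rewrite [leRHS]/Num.norm /= mx_normrE.
exact: (le_bigmax _ (fun p => `|u p.1 p.2|) (ord0, i)).
Qed.

Lemma norm_rV_le n (u : 'rV[R]_n) a : 0 <= a -> (forall i, `|u ord0 i| <= a) ->
  `|u| <= a.
Proof.
move=> a0 ua; rewrite [leLHS]/Num.norm /= mx_normrE.
by apply/bigmax_leP; split=> // -[i j] _; rewrite ord1.
Qed.

Lemma norm_rV_lt n (u : 'rV[R]_n) a : 0 < a -> (forall i, `|u ord0 i| < a) ->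
  `|u| < a.
Proof.
move=> a0 ua; rewrite [ltLHS]/Num.norm /= mx_normrE.
by apply/bigmax_ltP; split=> // -[i j] _; rewrite ord1.
Qed.

Definition centered t : 'rV[R]_m.+1 := 2 *: t - const_mx 1.

Lemma centeredE t i : centered t ord0 i = 2 * t ord0 i - 1.
Proof. by rewrite !mxE. Qed.

Lemma cube_to_sphere0E t :
  cube_to_sphere t ord0 ord0 = - cos (pi * `|centered t|).
Proof.
have -> : (ord0 : 'I_m.+2) = lshift m.+1 (ord0 : 'I_1) by exact/val_inj.
rewrite /cube_to_sphere -/(centered t) /=.
by apply: (etrans (row_mxEl _ _ _ _)); rewrite mxE.
Qed.

Lemma cube_to_sphereSE t i : cube_to_sphere t ord0 (lift ord0 i) =
  sin (pi * `|centered t|) / l2norm (centered t ord0) * centered t ord0 i.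
Proof.
have -> : (lift ord0 i : 'I_m.+2) = rshift 1 i by exact/val_inj.
rewrite /cube_to_sphere -/(centered t) /=.
by apply: (etrans (row_mxEr _ _ _ _)); rewrite mxE.
Qed.

Lemma cube_to_sphere_sphere t : sphere R m.+1 (cube_to_sphere t).
Proof.
apply/sphereP; rewrite big_ord_recl cube_to_sphere0E sqrrN.
under eq_bigr do rewrite cube_to_sphereSE exprMn.
rewrite -mulr_sumr -l2norm_sqr -exprMn.
(* At the centre of the cube the quotient is 0 / 0 = 0, and the point is the antipode of the base
   point. *)
have [->|u0] := eqVneq (centered t) 0.
  rewrite normr0 mulr0 cos0 sin0 !mul0r; ring.
by rewrite divfK ?l2norm_eq0 // cos2Dsin2.
Qed.

Lemma cube_centered t : cube t -> `|centered t| <= 1.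
Proof.
move=> ct; apply: norm_rV_le => // i; rewrite centeredE.
by have /andP[] := ct i; rewrite ler_norml => ??; apply/andP; split; lra.
Qed.

Lemma cube_boundary_centered t : cube_boundary t -> `|centered t| = 1.
Proof.
move=> [ct [i ti]]; apply/le_anti; rewrite cube_centered //=.
apply: le_trans (coord_le_norm _ i); rewrite centeredE.
by case: ti => ->; rewrite ?mulr0 ?mulr1 ?sub0r ?normrN ?normr1 // ger0_norm; lra.
Qed.

Lemma cube_interior_centered t : cube t -> ~ cube_boundary t -> `|centered t| < 1.
Proof.
move=> ct nb; apply: norm_rV_lt => // i; rewrite centeredE.
have /andP[t0 t1] := ct i.
have ti0 : t ord0 i != 0 by apply/eqP => e; apply: nb; split=> //; exists i; left.
have ti1 : t ord0 i != 1 by apply/eqP => e; apply: nb; split=> //; exists i; right.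
have {}t0 : 0 < t ord0 i by rewrite lt_def ti0.
have {}t1 : t ord0 i < 1 by rewrite lt_def eq_sym ti1.
by rewrite ltr_norml; apply/andP; split; lra.
Qed.

Lemma cube_to_sphere_boundary t : cube_boundary t -> cube_to_sphere t = base.
Proof.
move=> bt; apply/rowP => j; case: (unliftP ord0 j) => [i ->|->].
  by rewrite cube_to_sphereSE cube_boundary_centered // mulr1 sinpi !mul0r mxE.
by rewrite cube_to_sphere0E cube_boundary_centered // mulr1 cospi opprK mxE eqxx.
Qed.

Lemma sin_pi_gt0 (a : R) : 0 < a -> a < 1 -> 0 < sin (pi * a).
Proof.
move=> a0 a1; apply: sin_gt0_pi; rewrite mulr_gt0 ?pi_gt0 //=.
by rewrite -[ltRHS]mulr1 ltr_pM2l ?pi_gt0.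
Qed.

Lemma sin_pi_ge0 (a : R) : 0 <= a -> a <= 1 -> 0 <= sin (pi * a).
Proof.
move=> a0 a1; apply: sin_ge0_pi; rewrite mulr_ge0 ?pi_ge0 //=.
by rewrite -[leRHS]mulr1 ler_pM2l ?pi_gt0.
Qed.

Lemma cube_to_sphere_axis1 t : cube_to_sphere t ord0 axis1 =
  sin (pi * `|centered t|) / l2norm (centered t ord0) * (2 * t ord0 ord0 - 1).
Proof. by rewrite cube_to_sphereSE centeredE. Qed.

Lemma cube_to_sphere_right t : cube t -> 2^-1 <= t ord0 ord0 ->
  0 <= cube_to_sphere t ord0 axis1.
Proof.
move=> ct t2; rewrite cube_to_sphere_axis1 mulr_ge0 //; last lra.
by rewrite divr_ge0 ?l2norm_ge0 // sin_pi_ge0 // cube_centered.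
Qed.

Lemma cube_to_sphere_flip t :
  cube_to_sphere (set_first t (1 - t ord0 ord0)) = flip (cube_to_sphere t).
Proof.
set t' := set_first _ _.
have E i : centered t' ord0 i = if i == ord0 then - centered t ord0 i
    else centered t ord0 i.
  by rewrite !centeredE mxE; case: eqP => [->|//]; ring.
have En : `|centered t'| = `|centered t|.
  by apply/le_anti/andP; split; apply: norm_rV_le => // i;
    have := coord_le_norm (centered t) i; have := coord_le_norm (centered t') i;
    rewrite E; case: eqP => _; rewrite ?normrN.
have El : l2norm (centered t' ord0) = l2norm (centered t ord0).
  congr Num.sqrt; apply: eq_bigr => i _; rewrite E.
  by case: eqP => // _; rewrite sqrrN.
apply/rowP => j; rewrite [RHS]mxE; case: (unliftP ord0 j) => [i ->|->].
  rewrite !cube_to_sphereSE En El E /axis1 (inj_eq lift_inj).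
  by case: eqP => // _; rewrite mulrN.
by rewrite !cube_to_sphere0E En.
Qed.

Lemma l2norm_continuous n : continuous (fun u : 'rV[R]_n => l2norm (u ord0)).
Proof.
move=> u; apply: (@continuous_comp _ _ _ (fun u : 'rV[R]_n => \sum_i u ord0 i ^+ 2)
  (fun x => Num.sqrt x)); last exact: sqrt_continuous.
apply: (@cvg_bigsum _ _ (nbhs u) _ R^o) => i.
have cc := @coord_continuous R 1 n ord0 i u.
exact: (cvgM cc cc).
Qed.

Lemma pi_norm_continuous n : continuous (fun u : 'rV[R]_n => pi * `|u| : R).
Proof. by apply: Defs.scale_continuous; exact: norm_continuous. Qed.

Lemma sin_pi_norm_continuous n : continuous (fun u : 'rV[R]_n => sin (pi * `|u|)).
Proof.
move=> u; apply: (@continuous_comp _ _ _ (fun u : 'rV[R]_n => pi * `|u|) (@sin R)).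
  exact: pi_norm_continuous.
exact: continuous_sin.
Qed.

(** Only the origin needs care: a coordinate is at most the Euclidean norm, so the expression is
    squeezed by |sin (pi |u|)|, which tends to 0. *)
Lemma sphere_exp_continuous n (i : 'I_n.+1) :
  continuous (fun u : 'rV[R]_n.+1 => sin (pi * `|u|) / l2norm (u ord0) * u ord0 i).
Proof.
move=> u; have [->|u0] := eqVneq u 0; last first.
  have cl : (l2norm (v ord0))^-1 @[v --> u] --> (l2norm (u ord0))^-1.
    have l0 : l2norm (u ord0) != 0 by rewrite l2norm_eq0.
    exact: (cvgV l0 (@l2norm_continuous _ u)).
  exact: (cvgM (cvgM (@sin_pi_norm_continuous _ u) cl)
    (@coord_continuous R 1 n.+1 ord0 i u)).
rewrite /prop_for /continuous_at mxE mulr0.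
have sv : `|sin (pi * `|v|)| @[v --> (0 : 'rV[R]_n.+1)] --> 0.
  have := @sin_pi_norm_continuous n.+1 0.
  rewrite /continuous_at normr0 mulr0 sin0 => h.
  by have := cvg_norm h; rewrite normr0; apply.
have svN : - `|sin (pi * `|v|)| @[v --> (0 : 'rV[R]_n.+1)] --> 0.
  by have := @cvgN _ R^o _ _ _ _ _ sv; rewrite oppr0; apply.
apply: squeeze_cvgr svN sv; apply: nearW => v; rewrite -ler_norml.
rewrite normrM normrM -mulrA -[leRHS]mulr1 ler_wpM2l //.
have [->|v0] := eqVneq v 0; first by rewrite mxE normr0 mulr0.
rewrite normfV (ger0_norm (l2norm_ge0 _)) ler_pdivrMl ?l2norm_gt0 // mulr1.
exact: ler_l2norm.
Qed.

Lemma centered_continuous : continuous centered.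
Proof.
apply: mx_continuous => i j.
rewrite (_ : (fun x => _) = (fun t => 2 * t i j + - 1)).
  exact/affine_continuous/coord_continuous.
by apply/funext => t; rewrite !mxE.
Qed.

Lemma cube_to_sphere_continuous : continuous (@cube_to_sphere R m.+1).
Proof.
apply: mx_continuous => i j; rewrite ord1; case: (unliftP ord0 j) => [l ->|->].
  rewrite (_ : (fun x => _) = (fun u => sin (pi * `|u|) / l2norm (u ord0) * u ord0 l)
    \o centered); last by apply/funext => t; rewrite cube_to_sphereSE.
  move=> t; apply: continuous_comp; first exact: centered_continuous.
  exact: sphere_exp_continuous.
rewrite (_ : (fun x => _) = (fun u => - cos (pi * `|u|)) \o centered); last first.
  by apply/funext => t; rewrite cube_to_sphere0E.
move=> t; apply: continuous_comp; first exact: centered_continuous.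
have cc : continuous (fun u : 'rV[R]_m.+1 => cos (pi * `|u|)).
  move=> u; apply: (@continuous_comp _ _ _ (fun u : 'rV[R]_m.+1 => pi * `|u|) (@cos R)).
    exact: pi_norm_continuous.
  exact: continuous_cos.
exact: (@cvgN _ R^o _ _ _ _ _ (cc _)).
Qed.

End cube_to_sphere.

(** * The segment between the doubling map and the pinch map *)

Section pinch_homotopy.
Context {R : realType} {m : nat}.
Implicit Types (s : R) (t : 'rV[R]_m.+1).
Local Notation base := (delta_mx ord0 ord0 : 'rV[R]_m.+2).

(** Composed with [pinch], a cube becomes its concatenation with the constant cube. *)
Definition pinch t := set_first t (Num.min (2 * t ord0 ord0) 1).

Lemma pinch_itv t : cube t -> unit_itv (Num.min (2 * t ord0 ord0) 1).
Proof.
move=> ct; have := first_itv ct; rewrite /unit_itv /= => /andP[t0 t1].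
by rewrite le_min ge_min lexx orbT; lra.
Qed.

Lemma pinch_cube t : cube t -> cube (pinch t).
Proof. by move=> ct; apply: set_first_cube => //; exact: pinch_itv. Qed.

Lemma pinch_boundary t : cube_boundary t -> cube_boundary (pinch t).
Proof.
move=> bt; apply: set_first_boundary => //; first exact/pinch_itv/(proj1 bt).
by case=> ->; [left; rewrite min_l|right; rewrite min_r]; lra.
Qed.

Lemma pinch_right t : cube t -> 2^-1 <= t ord0 ord0 -> cube_boundary (pinch t).
Proof.
move=> ct t2; split; first exact: pinch_cube.
by exists ord0; right; rewrite set_firstE min_r //; lra.
Qed.

(** Radial extensions will be applied to these points: the segment may leave the sphere but must
    miss the origin. *)
Definition pinch_path s t : 'rV[R]_m.+2 :=
  (1 - s) *: doubling (cube_to_sphere t) + s *: cube_to_sphere (pinch t).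

Lemma pinch_path_right s t : cube t -> 2^-1 <= t ord0 ord0 ->
  pinch_path s t = base.
Proof.
move=> ct t2; rewrite /pinch_path doubling_right ?cube_to_sphere_right //.
rewrite (sqn_sphere (cube_to_sphere_sphere _)) expr1n scale1r.
rewrite (cube_to_sphere_boundary (pinch_right ct t2)) -scalerDl subrK.
exact: scale1r.
Qed.

Lemma pinch_path_boundary s t : cube_boundary t -> pinch_path s t = base.
Proof.
move=> bt; rewrite /pinch_path (cube_to_sphere_boundary (pinch_boundary bt)).
have e := cube_to_sphere_boundary bt.
rewrite doubling_right; last by rewrite e mxE.
rewrite (sqn_sphere (cube_to_sphere_sphere _)) expr1n scale1r -scalerDl subrK.
exact: scale1r.
Qed.

Lemma cos_pi_pos (z : R) : - 1 < 2 * z -> 2 * z < 1 -> 0 < cos (pi * z).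
Proof.
move=> z1 z2; have p0 := pi_gt0 R; apply: cos_gt0_pihalf.
by apply/andP; split; nra.
Qed.

Lemma cos_pi_neg (z : R) : 1 < 2 * z -> z < 1 -> cos (pi * z) < 0.
Proof.
move=> z1 z2; have -> : pi * z = pi + pi * (z - 1) by ring.
rewrite cosD cospi sinpi mul0r subr0 mulN1r oppr_lt0.
by apply: cos_pi_pos; lra.
Qed.

(** In the remaining region, the interior of the left half, some coordinate has the same strict sign
    at both ends of the segment. A zero forces all coordinates of the cube but the first to be
    centred, and then [axis1] is such a coordinate, or coordinate 0 is when [v] vanishes. *)
Lemma pinch_path_neq0 s t : unit_itv s -> cube t -> pinch_path s t != 0.
Proof.
rewrite /unit_itv /= => /andP[s0 s1] ct; apply/eqP => E0.
have base0 : base <> 0.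
  by move/rowP => /(_ ord0); rewrite !mxE eqxx; move/eqP; rewrite oner_eq0.
have [t2|t2] := leP 2^-1 (t ord0 ord0).
  by rewrite pinch_path_right in E0.
have [bt|bt] := pselect (cube_boundary t).
  by rewrite pinch_path_boundary in E0.
have E j : (1 - s) * doubling (cube_to_sphere t) ord0 j +
    s * cube_to_sphere (pinch t) ord0 j = 0.
  by have := f_equal (fun w : 'rV[R]_m.+2 => w ord0 j) E0; rewrite !mxE.
have t0 : 0 < t ord0 ord0.
  rewrite lt_def; have /andP[-> _] := ct ord0; rewrite andbT.
  by apply/eqP => e; apply: bt; split=> //; exists ord0; left.
set u := centered t in E *; set v := centered (pinch t).
have u0E : u ord0 ord0 = 2 * t ord0 ord0 - 1 by rewrite centeredE.
have v0E : v ord0 ord0 = 2 * u ord0 ord0 + 1.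
  by rewrite u0E centeredE set_firstE min_l; lra.
have vE i : i != ord0 -> v ord0 i = u ord0 i.
  by move=> i0; rewrite !centeredE mxE (negbTE i0).
have u0 : u != 0 by apply/eqP => e; move: u0E; rewrite e mxE; lra.
have nu0 : 0 < `|u| by rewrite normr_gt0.
have nu1 : `|u| < 1 by exact: cube_interior_centered.
have nv1 : `|v| < 1.
  apply: norm_rV_lt => // i; have [->|i0] := eqVneq i ord0.
    by rewrite ltr_norml v0E u0E; apply/andP; split; lra.
  by rewrite vE //; apply: le_lt_trans nu1; exact: coord_le_norm.
pose g := sin (pi * `|u|) / l2norm (u ord0).
have g0 : 0 < g by rewrite divr_gt0 ?l2norm_gt0 // sin_pi_gt0.
have xE i : cube_to_sphere t ord0 (lift ord0 i) = g * u ord0 i.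
  by rewrite cube_to_sphereSE.
have x1 : cube_to_sphere t ord0 axis1 < 0.
  by rewrite xE pmulr_rlt0 // u0E; lra.
have c0 : 0 < cutoff (cube_to_sphere t).
  rewrite /cutoff cap_left ?ltW // oppr_gt0 nmulr_rlt0 //.
  by rewrite exprn_even_gt0 //= lt_eqF.
(* Here [t] is the centre of the left half, and coordinate 0 is -1 at both ends. *)
have [v0|v0] := eqVneq v 0.
  have u12 : 2 * u ord0 ord0 + 1 = 0 by rewrite -v0E v0 mxE.
  have ui i : i != ord0 -> u ord0 i = 0 by move=> i0; rewrite -vE // v0 mxE.
  have nu : `|u| = 2^-1.
    apply/le_anti/andP; split.
      apply: norm_rV_le => // i; have [->|i0] := eqVneq i ord0.
        by rewrite ler_norml; apply/andP; split; lra.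
      by rewrite ui // normr0.
    apply: le_trans (coord_le_norm u ord0).
    by rewrite ler_normr; apply/orP; right; lra.
  have x00 : cube_to_sphere t ord0 ord0 = 0.
    by rewrite cube_to_sphere0E -/u nu cos_pihalf oppr0.
  have q1 : cap (cube_to_sphere t) = 1.
    rewrite cap_left ?ltW //; have := sqn_sphere (cube_to_sphere_sphere t).
    rewrite /sqn big_ord_axis x00 big1 => [|i _]; first by move=> <-; ring.
    by rewrite xE ui // mulr0 expr0n.
  have := E ord0; rewrite doubling0E q1 (sqn_sphere (cube_to_sphere_sphere t)).
  by rewrite cube_to_sphere0E -/v v0 normr0 mulr0 cos0; lra.
pose a := sin (pi * `|v|) / l2norm (v ord0).
have a0 : 0 < a by rewrite divr_gt0 ?l2norm_gt0 // sin_pi_gt0 ?normr_gt0.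
have yE i : cube_to_sphere (pinch t) ord0 (lift ord0 i) = a * v ord0 i.
  by rewrite cube_to_sphereSE.
set c := cutoff _ in c0.
have sA (p q : R) : 0 < p -> 0 < q -> (1 - s) * p + s * q != 0.
  move=> p0 q0; apply: lt0r_neq0; have [->|sn0] := eqVneq s 0.
    by rewrite subr0 mul1r mul0r addr0.
  have {}sn0 : 0 < s by rewrite lt_def sn0.
  by rewrite ltr_wpDl ?mulr_gt0 // mulr_ge0 ?subr_ge0 // ltW.
(* Both ends have positive multiples of the same number in this coordinate. *)
have ui i : u ord0 (lift ord0 i) = 0.
  have := E (lift ord0 (lift ord0 i)); rewrite doubling2E -/c xE yE vE //.
  have -> : (1 - s) * (c * (g * u ord0 (lift ord0 i))) + s * (a * u ord0 (lift ord0 i)) =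
    ((1 - s) * (c * g) + s * a) * u ord0 (lift ord0 i) by ring.
  move/eqP; rewrite mulf_eq0 (negbTE (sA _ _ (mulr_gt0 c0 g0) a0)).
  by move/eqP.
have nu : `|u| = - u ord0 ord0.
  apply/le_anti/andP; split; last first.
    by apply: le_trans (coord_le_norm u ord0); rewrite ler_normr lexx orbT.
  have un j : `|u ord0 j| <= - u ord0 ord0.
    case: (unliftP ord0 j) => [l ->|->]; first by rewrite ui normr0 u0E; lra.
    by rewrite ltr0_norm // u0E; lra.
  by apply: norm_rV_le un; rewrite u0E; lra.
(* With z = |u|, the two ends are positive multiples of cos (pi z) and of 1 - 2 z, which have the
   same sign for 0 < z < 1 and vanish only at z = 1/2, that is for [v] = 0. *)
have := E axis1; rewrite doubling1E -/c yE cube_to_sphere0E -/u nu.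
rewrite (_ : - (c * _) = c * cos (pi * - u ord0 ord0)); last by ring.
rewrite -/v v0E.
have z0 : - u ord0 ord0 < 1 by rewrite -nu.
rewrite (_ : 2 * u ord0 ord0 + 1 = 1 - 2 * - u ord0 ord0); last by ring.
have v0z : 1 - 2 * - u ord0 ord0 != 0.
  apply: contraNneq v0 => z.
  have vj j : v ord0 j = 0.
    by case: (unliftP ord0 j) => [l ->|->]; [rewrite vE ?ui|rewrite v0E; lra].
  by apply/eqP/rowP => j; rewrite [RHS]mxE; exact: vj.
move: z0 v0z; move: (- u ord0 ord0) nu => z nu z1 vz.
have [z2|z2] := ltP (2 * z) 1; move/eqP; apply/negP.
  apply: (sA _ _ (mulr_gt0 c0 _) (mulr_gt0 a0 _)); last by lra.
  by apply: cos_pi_pos; lra.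
have {}z2 : 1 < 2 * z.
  by rewrite lt_def z2 andbT; apply: contra_neq vz => ->; rewrite subrr.
rewrite -oppr_eq0 opprD -!mulrN.
apply: (sA _ _ (mulr_gt0 c0 _) (mulr_gt0 a0 _)); rewrite oppr_gt0; last by lra.
by apply: cos_pi_neg; lra.
Qed.

Lemma pinch_continuous : continuous pinch.
Proof.
have c2 : continuous (fun t : 'rV[R]_m.+1 => 2 * t ord0 ord0).
  by apply: Defs.scale_continuous; exact: coord_continuous.
have cm : continuous (fun t : 'rV[R]_m.+1 => Num.min (2 * t ord0 ord0) 1).
  by move=> t; exact: (@continuous_min _ _ _ (fun=> 1) t (c2 t) (@cst_continuous _ R^o 1 t)).
by apply: set_first_continuous => // t; exact: cvg_id.
Qed.

Lemma pinch_path_continuous : continuous (fun p => pinch_path p.1 p.2).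
Proof.
have cc := @cube_to_sphere_continuous R m.
move=> [s t]; rewrite /pinch_path; apply: cvgD; apply: cvgZ.
- by apply: (@cvgB _ R^o); [exact: cvg_cst|exact: cvg_fst].
- apply: (@continuous_comp _ _ _ snd (doubling \o @cube_to_sphere R m.+1)).
    exact: cvg_snd.
  apply: continuous_comp; first exact: cc.
  have [d _] := is_diff_doubling (cube_to_sphere t).
  exact: differentiable_continuous d.
- exact: cvg_fst.
- apply: (@continuous_comp _ _ _ snd (@cube_to_sphere R m.+1 \o pinch)).
    exact: cvg_snd.
  by apply: continuous_comp; [exact: pinch_continuous|exact: cc].
Qed.

End pinch_homotopy.

(** * Gluing two maps along the equator *)

Section division.
Context {R : realType} {m n : nat}.
Implicit Types (f g : 'rV[R]_m.+2 -> 'rV[R]_n.+1) (x : 'rV[R]_m.+2).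
Implicit Types a b : homotopy_group R m.+1 (sphere_base R n).
Local Notation base := (delta_mx ord0 ord0 : 'rV[R]_m.+2).
Local Notation basen := (delta_mx ord0 ord0 : 'rV[R]_n.+1).

(** The corner 0 of the cube is a boundary point, where a cube takes the base value. *)
Lemma in_homotopy_class_base f a : in_homotopy_class f a -> f base = basen.
Proof.
have b0 : cube_boundary (0 : 'rV[R]_m.+1).
  by split=> [i|]; [rewrite mxE lexx ler01|exists ord0; left; rewrite mxE].
move=> [g _ fg]; rewrite -(cube_to_sphere_boundary b0) -fg; last by case: b0.
by rewrite cube_map_boundary.
Qed.

Lemma radial_ext_base f : f base = basen -> radial_ext f base = basen.
Proof.
by move=> fb; rewrite radial_ext_sphere //; exact: (set_mem (valP (sphere_base R m.+1))).
Qed.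

Lemma radial_ext_doubling_right f x : f base = basen -> x != 0 ->
  0 <= x ord0 axis1 -> radial_ext f (doubling x) = basen.
Proof.
move=> fb x0 x1.
by rewrite doubling_right // radial_ext_scale ?exprn_gt0 ?sqn_gt0 // radial_ext_base.
Qed.

(* [f] on the half sphere [x axis1 <= 0], and [g] mirrored on the other half:
   each summand equals the base point where the other one varies. *)
Definition sphere_div f g x : 'rV[R]_n.+1 :=
  radial_ext f (doubling x) + radial_ext g (doubling (flip x)) - basen.

Lemma flip_axis1 x : flip x ord0 axis1 = - x ord0 axis1.
Proof. by rewrite flipE eqxx. Qed.

Lemma sphere_div_left f g x : g base = basen -> x != 0 -> x ord0 axis1 <= 0 ->
  sphere_div f g x = radial_ext f (doubling x).
Proof.
move=> gb x0 x1; rewrite /sphere_div (radial_ext_doubling_right gb) ?flip_neq0 //.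
  by rewrite addrK.
by rewrite flip_axis1 oppr_ge0.
Qed.

Lemma sphere_div_right f g x : f base = basen -> x != 0 -> 0 <= x ord0 axis1 ->
  sphere_div f g x = radial_ext g (doubling (flip x)).
Proof. by move=> fb x0 x1; rewrite /sphere_div radial_ext_doubling_right // addrC addKr. Qed.

Lemma doubling_flip_neq0 x : x != 0 -> doubling (flip x) != 0.
Proof. by move=> x0; rewrite doubling_neq0 // flip_neq0. Qed.

Lemma doubling_flipZ (l : R) x : 0 < l ->
  (doubling \o flip) (l *: x) = l ^+ 4 *: (doubling \o flip) x.
Proof. by move=> l0; rewrite /= flipZ doublingZ. Qed.

Lemma radial_ext_sphere_div f g : radial_ext (sphere_div f g) = sphere_div f g.
Proof.
have ef := @radial_ext_precomp _ _ _ 4 f doubling (@doublingZ R m).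
have eg := @radial_ext_precomp _ _ _ 4 g (doubling \o flip) doubling_flipZ.
apply/funext => x; rewrite [LHS]/radial_ext /sphere_div; congr (_ + _ - _).
  exact: (f_equal (fun F => F x) ef).
exact: (f_equal (fun F => F x) eg).
Qed.

Lemma C1_off0_doubling f : C1_sphere_map f -> C1_off0 (radial_ext f \o doubling).
Proof.
exact: (C1_off0_precomp (@is_diff_doubling R m) (@ddoubling_continuous R m)
  (@doubling_neq0 R m)).
Qed.

Lemma C1_off0_doubling_flip f : C1_sphere_map f ->
  C1_off0 (radial_ext f \o (doubling \o flip)).
Proof.
exact: (C1_off0_precomp (@is_diff_doubling_flip R m)
  (@ddoubling_flip_continuous R m) doubling_flip_neq0).
Qed.

Lemma C1_sphere_div f g : C1_sphere_map f -> C1_sphere_map g ->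
  f base = basen -> g base = basen -> C1_sphere_map (sphere_div f g).
Proof.
move=> Cf Cg fb gb.
have [C _] := C1_off0_add_cst basen (C1_off0_doubling Cf) (C1_off0_doubling_flip Cg).
split=> [x /sphere_neq0 x0|x x0|x v x0]; rewrite ?radial_ext_sphere_div.
- have [x1|/ltW x1] := leP 0 (x ord0 axis1).
    rewrite sphere_div_right //; apply: radial_ext_in_sphere => //.
    exact: doubling_flip_neq0.
  by rewrite sphere_div_left //; apply: radial_ext_in_sphere => //; exact: doubling_neq0.
- by have [] := C x x0.
- by have [_ h] := C x x0; exact: h.
Qed.

Lemma eq_jacobian (F G : 'rV[R]_m.+2 -> 'rV[R]_n.+1) x :
  (forall v, 'd F x v = 'd G x v) -> 'J F x = 'J G x.
Proof.
move=> FG; apply/matrixP => i j; rewrite [LHS]mxE [RHS]mxE.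
exact: (f_equal (fun w : 'rV[R]_n.+1 => w ord0 j) (FG _)).
Qed.

(** On each closed half sphere one of the two summands has zero differential, since its inner map
    has a radial one. The Jacobian is thus that of a single precomposition, even on the common
    equator. *)
Lemma minors_le_sphere_div k : exists2 K : R, 0 < K &
  forall f g c, C1_sphere_map f -> C1_sphere_map g ->
    f base = basen -> g base = basen -> 0 <= c ->
    (forall x, sphere R m.+1 x -> minors_le k ('J (radial_ext f) x) c) ->
    (forall x, sphere R m.+1 x -> minors_le k ('J (radial_ext g) x) c) ->
    forall x, sphere R m.+1 x ->
      minors_le k ('J (radial_ext (sphere_div f g)) x) (K * c).
Proof.
pose K0 : R := 10^-1^-1 ^+ k * (#|multi_index k m.+2|%:R * (k`!%:R * 12 ^+ k)).
have K00 : 0 <= K0 by rewrite !mulr_ge0 ?exprn_ge0.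
(* [K0] itself may vanish, when there is no multi-index of order [k]. *)
exists (K0 + 1); first by rewrite ltr_wpDl.
move=> f g c Cf Cg fb gb c0 fc gc x xS; rewrite radial_ext_sphere_div.
have x0 := sphere_neq0 xS.
have Kc : 10^-1^-1 ^+ k * (#|multi_index k m.+2|%:R * (k`!%:R * 12 ^+ k * c)) <=
    (K0 + 1) * c by rewrite -[leLHS](_ : K0 * c = _) ?ler_wpM2r ?lerDl // /K0; ring.
have [_ D] := C1_off0_add_cst basen (C1_off0_doubling Cf) (C1_off0_doubling_flip Cg).
have dS i : sphere R m.+1 (delta_mx ord0 i).
  apply/sphereP; rewrite (bigD1 i) //= big1 => [|j ji].
    by rewrite mxE !eqxx expr1n addr0.
  by rewrite mxE (negbTE ji) andbF expr0n.
have [x1|/ltW x1] := leP 0 (x ord0 axis1).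
- have -> : 'J (sphere_div f g) x = 'J (radial_ext g \o (doubling \o flip)) x.
    apply: eq_jacobian => v; apply: (etrans (D x _ x0)); apply: etrans (add0r _).
    apply: (f_equal (fun w => w + _)).
    exact: (diff_precomp_ray (@is_diff_doubling R m) (@doubling_neq0 R m) Cf x0
      (ddoubling_right _ x0 x1)).
  move=> I J; apply: le_trans Kc.
  apply: (minors_le_precomp (@is_diff_doubling_flip R m) doubling_flip_neq0 Cg
    (e := 10^-1) (B := 12)) => // [|i j].
    by rewrite l2norm_doubling_ge //; exact: sphere_flip.
  by apply: ddoubling_le; exact: sphere_flip.
- have -> : 'J (sphere_div f g) x = 'J (radial_ext f \o doubling) x.
    apply: eq_jacobian => v; apply: (etrans (D x _ x0)); apply: etrans (addr0 _).
    apply: (f_equal (fun w => _ + w)).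
    apply: (diff_precomp_ray (@is_diff_doubling_flip R m) doubling_flip_neq0 Cg x0
      (ddoubling_right _ (flip_neq0 x0) _)).
    by rewrite flip_axis1 oppr_ge0.
  move=> I J; apply: le_trans Kc.
  apply: (minors_le_precomp (@is_diff_doubling R m) (@doubling_neq0 R m) Cf
    (e := 10^-1) (B := 12)) => // [|i j].
    exact: l2norm_doubling_ge.
  exact: ddoubling_le.
Qed.

End division.

(** * The homotopy class of the glued map *)

Section division_class.
Context {R : realType} {m n : nat}.
Implicit Types (f g : 'rV[R]_m.+2 -> 'rV[R]_n.+1) (t : 'rV[R]_m.+1).
Implicit Types a b : homotopy_group R m.+1 (sphere_base R n).
Local Notation base := (delta_mx ord0 ord0 : 'rV[R]_m.+2).
Local Notation basen := (delta_mx ord0 ord0 : 'rV[R]_n.+1).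

Definition mirror t := set_first t (1 - t ord0 ord0).

Lemma mirrorE t : mirror t ord0 ord0 = 1 - t ord0 ord0.
Proof. exact: set_firstE. Qed.

Lemma mirror_itv t : cube t -> unit_itv (1 - t ord0 ord0).
Proof. by move=> /first_itv; rewrite /unit_itv /= => h; lra. Qed.

Lemma mirror_cube t : cube t -> cube (mirror t).
Proof. by move=> ct; apply: set_first_cube => //; exact: mirror_itv. Qed.

Lemma mirror_boundary t : cube_boundary t -> cube_boundary (mirror t).
Proof.
move=> bt; apply: set_first_boundary => //; first exact/mirror_itv/(proj1 bt).
by case=> ->; [right; rewrite subr0|left; rewrite subrr].
Qed.

Lemma mirror_continuous : continuous mirror.
Proof.
apply: set_first_continuous; first by move=> ?; exact: cvg_id.
by apply: rsub_continuous; exact: coord_continuous.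
Qed.

Lemma pinch_path0 t : pinch_path 0 t = doubling (cube_to_sphere t).
Proof. by rewrite /pinch_path subr0 scale1r scale0r addr0. Qed.

Lemma pinch_path1 t : pinch_path 1 t = cube_to_sphere (pinch t).
Proof. by rewrite /pinch_path subrr scale1r scale0r add0r. Qed.

(** The formula of [sphere_div] with the path in place of the doubling map: on each half of the cube
    one summand stays at the base point. *)
Definition div_homotopy f g (p : R * 'rV[R]_m.+1) : 'rV[R]_n.+1 :=
  radial_ext f (pinch_path p.1 p.2) +
  radial_ext g (pinch_path p.1 (mirror p.2)) - basen.

Lemma div_homotopy_left f g s t : g base = basen -> cube t ->
  t ord0 ord0 <= 2^-1 -> div_homotopy f g (s, t) = radial_ext f (pinch_path s t).
Proof.
move=> gb ct t2; rewrite /div_homotopy /= (@pinch_path_right _ _ _ (mirror t)).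
- by rewrite radial_ext_base // addrK.
- exact: mirror_cube.
- by rewrite mirrorE; lra.
Qed.

Lemma div_homotopy_right f g s t : f base = basen -> cube t ->
  2^-1 <= t ord0 ord0 ->
  div_homotopy f g (s, t) = radial_ext g (pinch_path s (mirror t)).
Proof.
move=> fb ct t2; rewrite /div_homotopy /= pinch_path_right //.
by rewrite radial_ext_base // addrC addKr.
Qed.

Lemma div_homotopy_continuous f g : C1_sphere_map f -> C1_sphere_map g ->
  {within @unit_itv R `*` @cube R m.+1, continuous (div_homotopy f g)}.
Proof.
move=> [_ df _] [_ dg _]; apply: continuous_in_subspaceT => -[s t] /set_mem[/= sI ct].
have cp := @pinch_path_continuous R m.
have cm : continuous (fun p : R * 'rV[R]_m.+1 => pinch_path p.1 (mirror p.2)).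
  move=> p; apply: (@continuous_comp _ _ _
    (fun p : R * 'rV[R]_m.+1 => (p.1, mirror p.2)) (fun p => pinch_path p.1 p.2)).
    apply: pair_continuous; first by move=> ?; exact: cvg_fst.
    move=> q; apply: (@continuous_comp _ _ _ snd mirror); first exact: cvg_snd.
    exact: mirror_continuous.
  exact: cp.
have F1 : {for (s, t), continuous
    (fun p : R * 'rV[R]_m.+1 => radial_ext f (pinch_path p.1 p.2))}.
  apply: (@continuous_comp _ _ _
    (fun p : R * 'rV[R]_m.+1 => pinch_path p.1 p.2) (radial_ext f)).
    exact: cp.
  exact/differentiable_continuous/df/pinch_path_neq0.
have F2 : {for (s, t), continuous
    (fun p : R * 'rV[R]_m.+1 => radial_ext g (pinch_path p.1 (mirror p.2)))}.
  apply: (@continuous_comp _ _ _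
    (fun p : R * 'rV[R]_m.+1 => pinch_path p.1 (mirror p.2)) (radial_ext g)).
    exact: cm.
  exact/differentiable_continuous/dg/pinch_path_neq0/mirror_cube.
exact: (cvgB (cvgD F1 F2) (cvg_cst _)).
Qed.

(** The homotopy starts at the glued map seen from the cube and ends at the concatenation of [f']
    with the inverse of [g']. *)
Lemma in_homotopy_class_div f g a b : C1_sphere_map f -> C1_sphere_map g ->
  in_homotopy_class f a -> in_homotopy_class g b ->
  in_homotopy_class (sphere_div f g) (homotopy_mul a (homotopy_inv b)).
Proof.
move=> Cf Cg fa gb.
have fb := in_homotopy_class_base fa; have gbb := in_homotopy_class_base gb.
move: fa gb => [f' -> Ef] [g' -> Eg].
have Ch := C1_sphere_div Cf Cg fb gbb.
pose h t := sphere_div f g (cube_to_sphere t).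
have H0 t : div_homotopy f g (0, t) = h t.
  by rewrite /div_homotopy /= !pinch_path0 cube_to_sphere_flip.
have HS s t : unit_itv s -> cube t -> sphere R n (div_homotopy f g (s, t)).
  move=> sI ct; have [t2|/ltW t2] := leP (t ord0 ord0) 2^-1.
    by rewrite div_homotopy_left //; apply: radial_ext_in_sphere => //; exact: pinch_path_neq0.
  rewrite div_homotopy_right //; apply: radial_ext_in_sphere => //.
  exact/pinch_path_neq0/mirror_cube.
have HB s t : unit_itv s -> cube_boundary t -> div_homotopy f g (s, t) = basen.
  move=> sI bt; rewrite /div_homotopy /= !pinch_path_boundary //; last exact: mirror_boundary.
  by rewrite !radial_ext_base // addrK.
have I0 : @unit_itv R 0 by rewrite /unit_itv /= lexx ler01.
(* The continuity of [h] is read off the slice s = 0 of the homotopy. *)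
have hc : {within @cube R m.+1, continuous h}.
  have := div_homotopy_continuous Cf Cg.
  move=> /(within_comp (P := @cube R m.+1) (phi := fun t => (0 : R, t))).
  move=> /(_ (pair_continuous (@cst_continuous _ _ _) (fun t => cvg_id))) H.
  rewrite (_ : h = div_homotopy f g \o (fun t => (0 : R, t))); first by apply: H.
  by apply/funext => t /=; rewrite H0.
have hS t : cube t -> sphere R n (h t) by move=> ct; rewrite -H0; exact: HS.
have hB t : cube_boundary t -> h t = val (sphere_base R n).
  by move=> bt; rewrite -H0; exact: HB.
exists (CubeMap hc hS hB) => //.
rewrite homotopy_class_inv homotopy_class_mul; apply/homotopy_classP/homotopic_sym.
exists (div_homotopy f g); split=> // [|t ct].
- exact: div_homotopy_continuous.
- rewrite cube_mulE; case: leP => t2.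
    rewrite div_homotopy_left // pinch_path1 radial_ext_sphere; last first.
      exact: cube_to_sphere_sphere.
    have e : pinch t = set_first t (2 * t ord0 ord0) by rewrite /pinch min_l //; lra.
    by rewrite -Ef ?e // -e; exact: pinch_cube.
  rewrite div_homotopy_right ?ltW // pinch_path1 radial_ext_sphere; last first.
      exact: cube_to_sphere_sphere.
  rewrite cube_invE set_firstE set_first_set.
  (* Mirroring the right half and then stretching it gives the reversed parameter that [cube_inv]
     uses. *)
  have e : pinch (mirror t) = set_first t (1 - (2 * t ord0 ord0 - 1)).
    rewrite /pinch mirrorE min_l; last by lra.
    by rewrite set_first_set; congr set_first; ring.
  by rewrite -Eg ?e // -e; exact/pinch_cube/mirror_cube.
Qed.

End division_class.

(** Constants are chosen backwards: [c] bounds the minors of the glued map, [c / K] those of [f] and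
    [g], and the further division by [C] turns this into a bound on their dilations. *)
Lemma small_dilation_classes_div (R : realType) (k m n : nat)
    (a b : homotopy_group R m.+1 (sphere_base R n)) :
  small_dilation_classes R k.+1 m.+1 n a -> small_dilation_classes R k.+1 m.+1 n b ->
  small_dilation_classes R k.+1 m.+1 n (homotopy_mul a (homotopy_inv b)).
Proof.
move=> aV bV d d0; have [c c0 cd] := dilation_lt_minors k.+1 m.+1 n d0.
have [C C0 Cm] := @minors_le_dilation R k m.+1.
have [K K0 Km] := @minors_le_sphere_div R m n k.+1.
have e0 : 0 < c / K / C by rewrite !divr_gt0.
have [f [Cf fa fe]] := aV _ e0; have [g [Cg gb ge]] := bV _ e0.
have cE : C * (c / K / C) = c / K by rewrite mulrC divfK ?gt_eqF.
exists (sphere_div f g); split.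
- by apply: C1_sphere_div; rewrite ?(in_homotopy_class_base fa) ?(in_homotopy_class_base gb).
- exact: in_homotopy_class_div.
- apply: cd => x xS; have -> : c = K * (c / K) by rewrite mulrC divfK ?gt_eqF.
  apply: Km => //; rewrite ?(in_homotopy_class_base fa) ?(in_homotopy_class_base gb) //.
  + by rewrite divr_ge0 ?ltW.
  + by move=> y yS; rewrite -cE; exact: (Cm _ _ _ _ Cf fe).
  + by move=> y yS; rewrite -cE; exact: (Cm _ _ _ _ Cg ge).
Qed.

(* k, m, n >= 1 appear as k.+1, m.+1, n.+1. *)
Theorem mainTheorem3 (R : realType) (k m n : nat) :
  group_closed
    (mem (small_dilation_classes R k.+1 m.+1 n.+1)) /\
  small_dilation_classes R k.+1 m.+1 n.+1 `<=`
    small_dilation_classes R k.+2 m.+1 n.+1.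
Proof.
split; last exact: small_dilation_classes_succ.
(* [group_closed] asks for the neutral element and for closure under [a / b]. *)
split=> [|a b]; first exact/mem_set/small_dilation_classes_one.
by move=> /set_mem aV /set_mem bV; exact/mem_set/small_dilation_classes_div.
Qed.
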